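(* Let $d\ge1$, let $m_1,\dots,m_d$ be positive integers, let $\lambda_1,\dots,\lambda_d$ be non-zero, pairwise distinct real numbers, and let $\alpha_1,\dots,\alpha_d>0$ and $c_1,\dots,c_d>0$. Let $$F=\sum_{i=1}^d\lambda_i\left(\gamma_i(m_i\alpha_i,c_i)-m_i\alpha_ic_i\right),$$ where $\gamma_1(m_1\alpha_1,c_1),\dots,\gamma_d(m_d\alpha_d,c_d)$ are independent gamma random variables with the indicated parameters. Let $Y$ be a real valued random variable such that $\mathbb{E}[|Y|]<+\infty$. Then $Y$ has the same law as $F$ if and only if $$\mathbb{E}\bigg[\Big(Y+\sum_{i=1}^d\lambda_im_i\alpha_ic_i\Big)(-1)^d\Big(\prod_{j=1}^d\lambda_jc_j\Big)f^{(d)}(Y)+\sum_{l=1}^{d-1}(-1)^l\Big(Y\,e_l((\lambda c))+\sum_{k=1}^d\lambda_km_k\alpha_kc_k\big(e_l((\lambda c))-e_l((\lambda c)_k)\big)\Big)f^{(l)}(Y)+Yf(Y)\bigg]=0$$ for all $f\in\mathcal{S}(\mathbb{R})$.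
   Context: For $\alpha,c>0$, $\gamma(\alpha,c)$ denotes a gamma random variable with shape $\alpha$ and scale $c$, i.e. with density $\frac{1}{c\,\Gamma(\alpha)}\left(\frac{x}{c}\right)^{\alpha-1}e^{-x/c}$ on $(0,\infty)$ and characteristic function $(1-ic\xi)^{-\alpha}$. For real numbers $x_1,\dots,x_n$, $e_k(x_1,\dots,x_n)=\sum_{1\le i_1<\dots<i_k\le n}x_{i_1}\cdots x_{i_k}$ is the elementary symmetric polynomial of order $k$, with $e_0=1$. $(\lambda c)$ denotes the $d$-tuple $(\lambda_1c_1,\dots,\lambda_dc_d)$, and $(\lambda c)_k$ denotes the $(d-1)$-tuple obtained from it by removing the $k$-th entry $\lambda_kc_k$. $\mathcal{S}(\mathbb{R})$ is the Schwartz space of smooth rapidly decreasing functions on $\mathbb{R}$. *)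

(* Defs.v *)
From HB Require Import structures.
From mathcomp Require Import all_boot all_order all_algebra.
From mathcomp Require Import all_classical all_reals all_analysis.
From mathcomp Require mpoly.

Set Implicit Arguments.
Unset Strict Implicit.
Unset Printing Implicit Defensive.

Import Order.TTheory GRing.Theory Num.Theory.
Import numFieldNormedType.Exports.

Local Open Scope classical_set_scope.
Local Open Scope ring_scope.

Definition elem_sym (R : comNzRingType) (n k : nat) (x : 'I_n -> R) : R :=
  mpoly.meval x (mpoly.mesym n R k).

Lemma elem_symE (R : comNzRingType) (n k : nat) (x : 'I_n -> R) :
  elem_sym k x = \sum_(A : {set 'I_n} | #|A| == k) \prod_(i in A) x i.
Proof.
rewrite /elem_sym /mpoly.mesym (big_morph _ (mpoly.mevalD x) (mpoly.meval0 x)).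
apply: eq_bigr => A _.
rewrite (big_morph _ (mpoly.mevalM x) (mpoly.meval1 x)).
by apply: eq_bigr => i _; rewrite mpoly.mevalXU.
Qed.

Definition drop_entry (T : Type) (n : nat) (k : 'I_n) (x : 'I_n -> T) :
  'I_n.-1 -> T := fun j => x (lift k j).

(* Euler's Gamma function, meaningful for [0 < a]. *)
Definition Gamma_fun (R : realType) (a : R) : R :=
  \int[lebesgue_measure]_(x in `]0, +oo[) (x `^ (a - 1) * expR (- x)).

(* [a] is the shape and [c] the scale (not the rate). *)
Definition gamma_pdf (R : realType) (a c : R) : R -> R :=
  (fun x => (c * Gamma_fun a)^-1 * (x / c) `^ (a - 1) * expR (- (x / c)))
    \_ `]0, +oo[.

Definition gamma_prob (R : realType) (a c : R) (A : set R) : \bar R :=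
  (\int[lebesgue_measure]_(x in A) (gamma_pdf a c x)%:E)%E.

Definition gamma_distributed (d : measure_display) (T : measurableType d)
    (R : realType) (P : probability T R) (X : {RV P >-> R}) (a c : R) : Prop :=
  forall A : set R, measurable A -> distribution P X A = gamma_prob a c A.

Arguments gamma_distributed [d T R] P X a c.

Definition mutually_independent (d : measure_display) (T : measurableType d)
    (R : realType) (P : probability T R) (I : finType)
    (X : I -> {RV P >-> R}) : Prop :=
  forall (J : {set I}) (B : I -> set R), (forall i, measurable (B i)) ->
    P (\bigcap_(i in [set` J]) X i @^-1` B i) =
    (\prod_(i in J) P (X i @^-1` B i))%E.

Arguments mutually_independent [d T R] P [I] X.

Definition same_law (R : realType)
    (d1 : measure_display) (T1 : measurableType d1) (P1 : probability T1 R)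
    (d2 : measure_display) (T2 : measurableType d2) (P2 : probability T2 R)
    (X1 : T1 -> R) (X2 : T2 -> R) : Prop :=
  forall A : set R, measurable A -> pushforward P1 X1 A = pushforward P2 X2 A.

Definition schwartz (R : realType) (f : R -> R) : Prop :=
  (forall (n : nat) (x : R), derivable f^`(n)%classic x 1) /\
  (forall k n : nat, exists M : R,
    forall x : R, `|x ^+ k * f^`(n)%classic x| <= M).

(* Main.v *)
Require Import Defs.
From HB Require Import structures.
From mathcomp Require Import all_boot all_order all_algebra.
From mathcomp Require Import all_classical all_reals all_analysis.
From mathcomp Require Import measurable_realfun ring lra.

Set Implicit Arguments.
Unset Strict Implicit.
Unset Printing Implicit Defensive.

Import Order.TTheory GRing.Theory Num.Theory.
Import numFieldNormedType.Exports.

Local Open Scope classical_set_scope.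
Local Open Scope ring_scope.

(** With [a_j = lambda_j c_j], [w_k = a_k m_k alpha_k], [D = d/dx],
    [A = \prod_j (1 - a_j D)] and [A_k = \prod_(j != k) (1 - a_j D)], the integrand is
    [Y (A f)(Y) + \sum_k w_k (A f - A_k f)(Y)].  Integrating by parts against a gamma
    density gives [E (G (phi - c phi')(G)) = c k E (phi G)]; conditioning on the other
    variables and applying this to [psi = A_k f], for which [A f = psi - a_k psi'], yields
    the identity for [F].
    Conversely, multiplying test functions by a dilated Gaussian extends the identity from
    Schwartz functions to smooth functions with bounded derivatives.  On the span of
    [cos (xi x)] and [sin (xi x)] the operators [1 - a_j D] are invertible, so the
    identity turns into a linear differential equation in [xi] for the characteristic
    function.  The difference of the characteristic functions of [Y] and [F] solves the
    same equation with initial value [0], and its modulus decreases away from [0], hence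
    the two coincide.  Finally the iterates of [t |-> (3 t - t ^ 3) / 2] turn
    trigonometric polynomials into indicator functions of half-lines. *)

(** * Differential operators with constant coefficients *)

(** A first moment of [Y] suffices because [Y] enters the integrand linearly while the derivatives
    of the test function are bounded: [M (1 + |Y|)] dominates all cut-offs at once. It also makes
    the characteristic function [phi] differentiable, which a first-order equation requires. With
    [g = A f] one has [A_k f = (1 - a_k D)^-1 g], so [A f - A_k f = - a_k D (1 - a_k D)^-1 g] and
    the identity reads [E (Y g(Y)) = \sum_k w_k a_k E (D (1 - a_k D)^-1 g)(Y)]. For
    [g = exp (i xi x)] this is [phi' = - \sum_k w_k a_k xi / (1 - i a_k xi) phi]. Since
    [w_k a_k = m_k alpha_k a_k ^ 2], the real part of the coefficient has the sign of [- xi],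
    whatever the signs of the [lambda_k]: this is why the modulus of a solution decreases away from
    [0]. The law of [F] is simply another solution of the same equation, so no solution has to be
    written down. Trigonometric polynomials are closed under products, hence under a polynomial
    iteration. Its iterates stay bounded by [1], and bounded convergence carries equality of
    integrals first to the sign of [sin (l (x - c))], then, as [l] tends to [0], to the sign of
    [x - c]. *)

Section smooth_functions.
Local Notation "f ^` ( n )" := (derive1n n f) : ring_scope.
Local Notation "f ^` ()" := (derive1 f) : ring_scope.
Context {R : realType}.
Implicit Types (f g : R -> R) (p : {poly R}).

Definition smooth f := forall n x, derivable f^`(n) x 1.

(** A class that contains both the Schwartz functions and the trigonometric ones and is stable under
    operators with constant coefficients. *)
Definition smooth_bounded f :=
  smooth f /\ forall n, exists M, forall x, `|f^`(n) x| <= M.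

Lemma smooth_derive1 f : smooth f -> smooth f^`().
Proof. by move=> sf n x; rewrite -derive1Sn; exact: sf. Qed.

Lemma smooth_is_derive f x : smooth f -> is_derive x (1 : R) f (f^`() x).
Proof.
move=> sf; have /derivableP := sf 0 x.
by rewrite derive1n0 -derive1E.
Qed.

Lemma derivable_is_derive f x : derivable f x (1 : R) -> is_derive x (1 : R) f (f^`() x).
Proof. by move=> /derivableP; rewrite derive1E. Qed.

Lemma is_derive_derive1 f x l : is_derive x (1 : R) f l -> f^`() x = l.
Proof. by move=> h; rewrite derive1E (@derive_val _ _ _ _ _ _ _ h). Qed.

Lemma derive1_lin f g (a b : R) : (forall x, derivable f x 1) -> (forall x, derivable g x 1) ->
  (fun x => a * f x + b * g x)^`() = (fun x => a * f^`() x + b * g^`() x).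
Proof.
move=> sf sg; apply/funext => x; apply: is_derive_derive1.
have /derivable_is_derive df := sf x; have /derivable_is_derive dg := sg x.
exact: (@is_deriveD _ _ _ (a *: f) (b *: g)).
Qed.

(** Differentiability is asked only below order [n]: the proof that products are smooth goes by
    induction on the order and has no more than this at hand. *)
Lemma derive1n_lin_upto f g (a b : R) n :
  (forall i x, (i < n)%N -> derivable f^`(i) x 1) ->
  (forall i x, (i < n)%N -> derivable g^`(i) x 1) ->
  (fun x => a * f x + b * g x)^`(n) = (fun x => a * f^`(n) x + b * g^`(n) x).
Proof.
elim: n => [//|n IH] df dg.
rewrite !derive1nS IH.
- by rewrite derive1_lin// => x; [exact: df|exact: dg].
- by move=> i x ni; apply: df; exact: ltnW.
- by move=> i x ni; apply: dg; exact: ltnW.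
Qed.

Lemma derive1n_lin f g (a b : R) n : smooth f -> smooth g ->
  (fun x => a * f x + b * g x)^`(n) = (fun x => a * f^`(n) x + b * g^`(n) x).
Proof. by move=> sf sg; apply: derive1n_lin_upto => i x _; [exact: sf|exact: sg]. Qed.

Lemma smooth_lin f g (a b : R) : smooth f -> smooth g ->
  smooth (fun x => a * f x + b * g x).
Proof.
move=> sf sg n x; rewrite derive1n_lin//.
by apply: (@derivableD _ _ _ (a *: f^`(n)) (b *: g^`(n))); apply: derivableZ; [exact: sf|exact: sg].
Qed.

Lemma smooth_bounded_lin f g (a b : R) : smooth_bounded f -> smooth_bounded g ->
  smooth_bounded (fun x => a * f x + b * g x).
Proof.
move=> [sf bf] [sg bg]; split; first exact: smooth_lin.
move=> n; have [M hM] := bf n; have [N hN] := bg n.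
exists (`|a| * M + `|b| * N) => x; rewrite derive1n_lin//.
by rewrite (le_trans (ler_normD _ _))// !normrM lerD// ler_wpM2l.
Qed.

Lemma smooth_bounded_derive1 f : smooth_bounded f -> smooth_bounded f^`().
Proof.
move=> [sf bf]; split; first exact: smooth_derive1.
by move=> n; have [M hM] := bf n.+1; exists M => x; rewrite -derive1Sn.
Qed.

Lemma smooth_bounded_cst0 : smooth_bounded (fun=> 0 : R).
Proof.
have d0 n : (fun=> 0 : R)^`(n) = (fun=> 0 : R).
  by elim: n => [//|n IH]; rewrite derive1nS IH; apply/funext => x; rewrite derive1_cst.
split=> [n x|n]; first by rewrite d0; exact: derivable_cst.
by exists 0 => x; rewrite d0 normr0.
Qed.

Definition diffop p f x := \sum_(i < size p) p`_i * f^`(i) x.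

Lemma diffopE p f x n : (size p <= n)%N ->
  diffop p f x = \sum_(i < n) p`_i * f^`(i) x.
Proof.
move=> pn; rewrite /diffop (big_ord_widen n (fun i => p`_i * f^`(i) x) pn).
rewrite big_mkcond/=; apply: eq_bigr => i _; case: ifPn => //.
by rewrite -leqNgt => ?; rewrite nth_default// mul0r.
Qed.

Lemma diffopD p q f x : diffop (p + q) f x = diffop p f x + diffop q f x.
Proof.
pose n := maxn (size p) (size q).
rewrite (@diffopE _ _ _ n) ?size_polyD// (@diffopE p _ _ n) ?leq_maxl//.
rewrite (@diffopE q _ _ n) ?leq_maxr// -big_split/=.
by apply: eq_bigr => i _; rewrite coefD mulrDl.
Qed.

Lemma diffopZ c p f x : diffop (c *: p) f x = c * diffop p f x.
Proof.
rewrite (@diffopE _ _ _ (size p)) ?size_scale_leq// big_distrr/=.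
by apply: eq_bigr => i _; rewrite coefZ mulrA.
Qed.

Lemma diffop1 f : diffop 1 f = f.
Proof.
by apply/funext => x; rewrite /diffop size_poly1 big_ord1 coef1 eqxx mul1r.
Qed.

Lemma is_derive_diffop p f x : smooth f ->
  is_derive x (1 : R) (diffop p f) (diffop ('X * p) f x).
Proof.
move=> sf.
have -> : diffop p f = \sum_(i < size p) (p`_i *: f^`(i)).
  by apply/funext => y; rewrite /diffop fct_sumE.
have h (i : 'I_(size p)) : is_derive x (1 : R) (p`_i *: f^`(i)) (p`_i *: f^`(i.+1) x).
  by apply: is_deriveZ; rewrite derive1nS; apply: derivable_is_derive; exact: sf.
have -> : diffop ('X * p) f x = \sum_(i < size p) (p`_i *: f^`(i.+1) x).
  have sX : (size ('X * p)%R <= (size p).+1)%N.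
    by rewrite (leq_trans (size_polyMleq _ _))// size_polyX.
  rewrite (diffopE _ _ sX).
  by rewrite big_ord_recl/= coefXM mul0r add0r; apply: eq_bigr => i _; rewrite coefXM.
exact: is_derive_sum.
Qed.

Lemma derive1_diffop p f : smooth f -> (diffop p f)^`() = diffop ('X * p) f.
Proof. by move=> sf; apply/funext => x; apply/is_derive_derive1/is_derive_diffop. Qed.

(** Multiplication of symbols is composition of operators; peeling off one linear factor is what
    yields [A f = psi - a_k psi'] for [psi = A_k f]. *)
Lemma diffopM_linear a p f x : smooth f ->
  diffop ((1 - a *: 'X) * p) f x = diffop p f x - a * (diffop p f)^`() x.
Proof.
move=> sf; rewrite mulrBl mul1r -scalerAl diffopD -scaleNr diffopZ mulNr.
by rewrite derive1_diffop.
Qed.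

Lemma smooth_bounded_diffop p f : smooth_bounded f -> smooth_bounded (diffop p f).
Proof.
move=> sf.
have H n : smooth_bounded (f^`(n)).
  by elim: n => [//|n IH]; rewrite derive1nS; exact: smooth_bounded_derive1.
rewrite /diffop; elim: (size p) => [|n IH].
  by under eq_fun do rewrite big_ord0; exact: smooth_bounded_cst0.
under eq_fun do rewrite big_ord_recr/=.
have := smooth_bounded_lin 1 p`_n IH (H n).
by under eq_fun do rewrite mul1r.
Qed.

Lemma schwartz_smooth_bounded f : schwartz f -> smooth_bounded f.
Proof.
move=> [sf bf]; split=> // n; have [M hM] := bf 0 n.
by exists M => x; have := hM x; rewrite expr0 mul1r.
Qed.

Lemma smooth_bounded_continuous f : smooth_bounded f -> continuous f.
Proof.
by move=> [sf _] x; apply: differentiable_continuous; apply/derivable1_diffP; exact: (sf 0 x).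
Qed.

End smooth_functions.

Section symbol_polynomial.
Local Notation "f ^` ( n )" := (derive1n n f) : ring_scope.
Context {R : realType} {d : nat}.
Implicit Types a : 'I_d -> R.

Definition symbol_poly a : {poly R} := \prod_j (1 - a j *: 'X).

(** Expanding the product chooses a set of factors that contribute [- a j *: 'X]; grouping these
    sets by cardinality produces the elementary symmetric polynomials. *)
Lemma symbol_polyE a : symbol_poly a = \sum_(l < d.+1) ((-1) ^+ l * elem_sym l a) *: 'X^l.
Proof.
have -> : symbol_poly a = \sum_(J : {set 'I_d}) ((-1) ^+ #|J| * \prod_(i in J) a i) *: 'X^#|J|.
  transitivity (\prod_j (- a j *: 'X + 1 : {poly R})).
    by apply: eq_bigr => j _; rewrite addrC scaleNr.
  rewrite bigA_distr; apply: eq_bigr => J _.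
  rewrite -(big_mkcond (fun i => i \in J) (fun i => - a i *: 'X)).
  under eq_bigr do rewrite scaleNr -mulN1r.
  rewrite big_split/= prodr_const scaler_prod prodr_const.
  by rewrite -scalerA -[in RHS]mul_polyC rmorphXn rmorphN1.
rewrite (partition_big (fun J : {set 'I_d} => inord #|J| : 'I_d.+1) predT)//=.
apply: eq_bigr => l _; rewrite elem_symE mulr_sumr scaler_suml.
apply: eq_big => [J|J /eqP <-].
  rewrite -val_eqE/= inordK// ltnS (leq_trans (max_card _))//.
  by rewrite card_ord.
by rewrite inordK// ltnS (leq_trans (max_card _))// card_ord.
Qed.

Lemma coef_symbol_poly a l :
  (symbol_poly a)`_l = if (l <= d)%N then (-1) ^+ l * elem_sym l a else 0.
Proof.
rewrite symbol_polyE -(poly_def d.+1 (fun l => (-1) ^+ l * elem_sym l a)).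
by rewrite coef_poly ltnS.
Qed.

Lemma diffop_symbol_poly a (f : R -> R) x :
  diffop (symbol_poly a) f x = \sum_(l < d.+1) (-1) ^+ l * elem_sym l a * f^`(l) x.
Proof.
rewrite (@diffopE _ _ _ _ d.+1); last first.
  rewrite symbol_polyE -(poly_def d.+1 (fun l => (-1) ^+ l * elem_sym l a)).
  exact: size_poly.
by apply: eq_bigr => l _; rewrite coef_symbol_poly -ltnS ltn_ord.
Qed.

End symbol_polynomial.

(** * Integrals, dominated convergence and densities *)

Section real_integrals.
Context d (T : measurableType d) (R : realType).
Variables (mu : {measure set T -> \bar R}) (D : set T) (mD : measurable D).
Implicit Types f g : T -> R.

Lemma le_integrable_EFin f g : measurable_fun D f ->
  (forall x, D x -> `|f x| <= g x) -> mu.-integrable D (EFin \o g) ->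
  mu.-integrable D (EFin \o f).
Proof.
move=> mf fg; apply: le_integrable => //; first exact/measurable_EFinP.
by move=> x Dx /=; rewrite lee_fin (le_trans (fg _ Dx))// ler_norm.
Qed.

Lemma dominated_cvg_Rintegral (f_ : nat -> T -> R) f g :
  (forall n, measurable_fun D (f_ n)) ->
  (forall x, D x -> f_ ^~ x @ \oo --> f x) ->
  mu.-integrable D (EFin \o g) ->
  (forall n x, D x -> `|f_ n x| <= g x) ->
  \int[mu]_(x in D) f_ n x @[n --> \oo] --> \int[mu]_(x in D) f x.
Proof.
move=> mf_ f_f ig fg.
have mf : measurable_fun D f by exact: (measurable_fun_cvg mf_ f_f).
have intf : mu.-integrable D (EFin \o f).
  apply: (le_integrable_EFin (g := g)) => // x Dx.
  have nf : `|f_ n x| @[n --> \oo] --> `|f x| by apply: cvg_norm; exact: f_f.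
  rewrite -(cvg_lim _ nf)//; apply: limr_le; first by apply/cvg_ex; exists `|f x|.
  by apply: nearW => n; exact: fg.
rewrite /Rintegral; apply: fine_cvg; rewrite fineK; last by apply: integrable_fin_num.
apply: (@dominated_cvg _ _ _ mu D mD (fun n x => (f_ n x)%:E) _ (EFin \o g)) => //.
- by move=> n; exact/measurable_EFinP.
- by move=> x Dx; apply: cvg_EFin; [exact: nearW|exact: f_f].
Qed.

End real_integrals.

Section probability_integrals.
Context d (T : measurableType d) (R : realType) (P : probability T R).
Implicit Types f g : T -> R.

Lemma bounded_integrable f M : measurable_fun setT f -> (forall x, `|f x| <= M) ->
  P.-integrable setT (EFin \o f).
Proof.
move=> mf fM; apply: (le_integrable_EFin measurableT (g := cst M)) => //.
exact: (finite_measure_integrable_cst P M measurableT).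
Qed.

Lemma integrable_mulr_bounded f g M : P.-integrable setT (EFin \o f) ->
  measurable_fun setT g -> (forall x, `|g x| <= M) ->
  P.-integrable setT (EFin \o (fun x => f x * g x)).
Proof.
move=> intf mg gM.
have /integrableP[/measurable_EFinP mf _] := intf.
apply: (le_integrable_EFin measurableT (g := fun x => M * `|f x|)) => //.
- exact: measurable_funM.
- by move=> x _; rewrite normrM mulrC ler_wpM2r.
- have := integrableZl measurableT M (integrable_norm intf).
  by apply: eq_integrable => // x _ /=; rewrite EFinM.
Qed.

End probability_integrals.

Section density.
Context d (T : measurableType d) (R : realType).
Variables (mu : {sigma_finite_measure set T -> \bar R}).
Variables (nu : {finite_measure set T -> \bar R}) (g : T -> R).
Hypotheses (mg : measurable_fun setT g) (g0 : forall x, 0 <= g x).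
Hypothesis nuE : forall A, measurable A -> nu A = (\int[mu]_(x in A) (g x)%:E)%E.

Let numu : nu `<< mu.
Proof.
apply/null_content_dominatesP => A mA A0; rewrite nuE//.
by apply: null_set_integral => //; apply/measurable_EFinP; exact: measurable_funTS.
Qed.

Lemma density_integrable : mu.-integrable setT (EFin \o g).
Proof.
apply/integrableP; split; first exact/measurable_EFinP.
under eq_integral => x _ do rewrite gee0_abs ?lee_fin//.
by rewrite -nuE//; rewrite ltey_eq fin_num_measure.
Qed.

(** The change of variables holds for the Radon-Nikodym derivative of [nu], and [g] equals it almost
    everywhere because both have the same integral over every measurable set. *)
Lemma ge0_integral_density (f : T -> \bar R) : (forall x, 0 <= f x)%E ->
  measurable_fun setT f ->
  (\int[nu]_x f x = \int[mu]_x (f x * (g x)%:E))%E.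
Proof.
move=> f0 mf.
rewrite -(Radon_Nikodym_SigmaFinite.change_of_variables numu f0 measurableT mf).
have iRN := Radon_Nikodym_SigmaFinite.f_integrable numu.
have mRN := measurable_int _ iRN.
have aeE : ae_eq mu setT (Radon_Nikodym_SigmaFinite.f nu mu) (EFin \o g).
  apply: integral_ae_eq => //; first exact/measurable_EFinP.
  by move=> E _ mE; rewrite -Radon_Nikodym_SigmaFinite.f_integral// nuE.
apply: ge0_ae_eq_integral => //.
- exact: emeasurable_funM.
- by apply: emeasurable_funM => //; exact/measurable_EFinP.
- by move=> x _; rewrite mule_ge0// Radon_Nikodym_SigmaFinite.f_ge0.
- by move=> x _; rewrite mule_ge0// lee_fin.
- exact: ae_eqe_mul2l.
Qed.

Lemma integrable_density (f : T -> R) : measurable_fun setT f ->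
  nu.-integrable setT (EFin \o f) <-> mu.-integrable setT (EFin \o (fun x => f x * g x)).
Proof.
move=> mf.
have E : (\int[nu]_x `|(f x)%:E| = \int[mu]_x `|(f x * g x)%:E|)%E.
  rewrite (ge0_integral_density (f := fun x => `|(f x)%:E|%E))//; last first.
    by apply: measurableT_comp => //; exact/measurable_EFinP.
  by apply: eq_integral => x _; rewrite EFinM abseM [`|(g x)%:E|%E]gee0_abs// lee_fin.
have mfg : measurable_fun setT (fun x => f x * g x) by exact: measurable_funM.
by split=> /integrableP[_ h]; apply/integrableP; split; try exact/measurable_EFinP;
  move: h; rewrite /= E.
Qed.

Lemma Rintegral_density (f : T -> R) : nu.-integrable setT (EFin \o f) ->
  \int[nu]_x f x = \int[mu]_x (f x * g x).
Proof.
move=> intf; have /integrableP[/measurable_EFinP mf _] := intf.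
rewrite /Rintegral [in LHS]integralE [in RHS]integralE.
have mEf : measurable_fun setT (EFin \o f) by exact/measurable_EFinP.
rewrite (ge0_integral_density (f := ((fun x => (f x)%:E)^\+)%E))//; last exact: measurable_funepos.
rewrite (ge0_integral_density (f := ((fun x => (f x)%:E)^\-)%E))//; last exact: measurable_funeneg.
congr (fine (_ - _)); apply: eq_integral => x _.
- by rewrite !funeposE EFinM maxe_pMl ?lee_fin// mul0e.
- by rewrite !funenegE -!EFinN -mulNr EFinM maxe_pMl ?lee_fin// mul0e.
Qed.

End density.

(** * The Stein identity of the gamma law *)

Section gamma_law.
Context {R : realType} (k c : R) (k0 : 0 < k) (c0 : 0 < c).
Local Notation leb := (@lebesgue_measure R).

Let K : R := (c * Gamma_fun k)^-1.
Let q (x : R) : R := K * (x / c) `^ (k - 1) * expR (- (x / c)).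
(** For [0 < x] this is [x * q x], with derivative [(k - x / c) * q x]. Its exponent is [k], not
    [k - 1], so it vanishes at [0] even when the density is unbounded there. *)
Let h (x : R) : R := K * c * (x / c) `^ k * expR (- (x / c)).

Let K_ge0 : 0 <= K.
Proof.
rewrite invr_ge0 mulr_ge0 ?(ltW c0)//.
by apply: Rintegral_ge0 => x _; rewrite mulr_ge0 ?powR_ge0 ?expR_ge0.
Qed.

Let q_ge0 x : 0 <= q x.
Proof. by rewrite !mulr_ge0 ?powR_ge0 ?expR_ge0. Qed.

Let h_ge0 x : 0 <= h x.
Proof. by rewrite !mulr_ge0 ?powR_ge0 ?expR_ge0 ?(ltW c0). Qed.

Let gamma_pdf_pos (x : R) : 0 < x -> gamma_pdf k c x = q x.
Proof. by move=> x0; rewrite /gamma_pdf patchE mem_set//= in_itv/= x0. Qed.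

Lemma gamma_pdf_ge0 x : 0 <= gamma_pdf k c x.
Proof. by rewrite /gamma_pdf patchE; case: ifPn => // _; exact: q_ge0. Qed.

Lemma measurable_gamma_pdf : measurable_fun setT (gamma_pdf k c).
Proof.
apply/(measurable_restrictT _ _).1 => //.
apply: measurable_funM; first apply: measurable_funM => //.
  apply/measurable_funTS; apply: (@measurableT_comp _ _ _ _ _ _ (fun y => y `^ (k - 1))) => //.
  exact: measurable_funM.
apply/measurable_funTS; apply: measurableT_comp => //.
by apply: measurableT_comp => //; exact: measurable_funM.
Qed.

Let derive_h (x : R) : 0 < x -> is_derive x (1 : R) h ((k - x / c) * q x).
Proof.
move=> x0; have xc0 : 0 < x / c by rewrite divr_gt0.
have dl : is_derive x (1 : R) ( *%R^~ c^-1) c^-1.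
  have := @is_deriveZ _ _ _ id c^-1 x 1 1 (is_derive_id _ _).
  rewrite (_ : c^-1 \*: _ = *%R^~ c^-1); last by apply/funext => y /=; rewrite mulrC.
  by rewrite [_ *: _]mulr1.
have dp := @is_derive1_comp _ (fun y => y `^ k) _ x _ _ (is_derive1_powR k xc0) dl.
have dn := @is_deriveN _ _ _ _ x 1 _ dl.
have de := @is_derive1_comp _ expR _ x _ _ (is_derive_expR _) dn.
have dm := is_deriveM (is_deriveZ (K * c) dp) de.
move: dm; set D := (X in is_derive _ _ _ X) => dm.
suff <- : D = (k - x / c) * q x by exact: dm.
rewrite /D /q /GRing.scale/= /GRing.scale/= /GRing.scale/=.
have -> : (x / c) `^ k = (x / c) * (x / c) `^ (k - 1) by rewrite mulr_powRB1// ltW.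
by field; rewrite gt_eqF.
Qed.

Let h_id_q (x : R) : 0 < x -> h x = x * q x.
Proof.
move=> x0; rewrite /h /q.
have -> : (x / c) `^ k = (x / c) * (x / c) `^ (k - 1).
  by rewrite mulr_powRB1// ltW// divr_gt0.
by field; rewrite gt_eqF.
Qed.

(** The fundamental theorem of calculus for [h * phi], on a compact interval away from [0] since [h]
    is differentiated only at positive points. *)
Let integral_stein_itv (phi dphi : R -> R) (s t : R) : 0 < s -> s < t ->
  (forall x, is_derive x (1 : R) phi (dphi x)) -> continuous dphi ->
  (\int[leb]_(x in `[s, t]) (((k - x / c) * phi x + x * dphi x) * gamma_pdf k c x)%:E
   = (h t * phi t - h s * phi s)%:E)%E.
Proof.
move=> s0 st Dphi cdphi.
have pos (x : R) : x \in `[s, t]%classic -> 0 < x.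
  by rewrite inE/= in_itv/= => /andP[sx _]; exact: lt_le_trans sx.
have Dh (x : R) : 0 < x -> is_derive x (1 : R) (fun x => h x * phi x)
    ((k - x / c) * q x * phi x + h x * dphi x).
  move=> x0; have := is_deriveM (derive_h x0) (Dphi x).
  set D := (X in is_derive _ _ _ X) => dm.
  suff <- : D = (k - x / c) * q x * phi x + h x * dphi x by exact: dm.
  by rewrite /D /GRing.scale/=; ring.
have ch (g : R -> R) (l x : R) : is_derive x (1 : R) g l -> {for x, continuous g}.
  by move=> dg; apply: differentiable_continuous; apply/derivable1_diffP; case: dg.
(* Writing the density as [h x / x] makes continuity of the integrand follow from the derivative of
   [h]. *)
transitivity (\int[leb]_(x in `[s, t]) (h x * ((k / x - c^-1) * phi x + dphi x))%:E)%E.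
  apply: eq_integral => x /pos x0; rewrite gamma_pdf_pos// h_id_q//; congr EFin.
  by field; rewrite !gt_eqF.
rewrite (@continuous_FTC2 _ _ (fun x => h x * phi x))//.
- apply: continuous_in_subspaceT => x /pos x0.
  have h1 : h z @[z --> x] --> h x by exact: (ch _ _ _ (derive_h x0)).
  have h2 : phi z @[z --> x] --> phi x by exact: (ch _ _ _ (Dphi x)).
  have h3 : z^-1 @[z --> x] --> x^-1 by apply: cvgV; [rewrite gt_eqF|exact: cvg_id].
  have h4 : k / z - c^-1 @[z --> x] --> k / x - c^-1.
    by apply: cvgB; [apply: cvgM => //; exact: cvg_cst|exact: cvg_cst].
  exact: cvgM h1 (cvgD (cvgM h4 h2) (cdphi x)).
- split.
  + move=> x; rewrite in_itv/= => /andP[sx _].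
    by have [] := Dh x (lt_trans s0 sx).
  + by apply: cvg_at_right_filter; exact: (ch _ _ _ (Dh s s0)).
  + by apply: cvg_at_left_filter; exact: (ch _ _ _ (Dh t (lt_trans s0 st))).
- move=> x; rewrite in_itv/= => /andP[sx _].
  have x0 := lt_trans s0 sx.
  rewrite (is_derive_derive1 (Dh _ x0)) h_id_q//.
  by field; rewrite !gt_eqF.
Qed.

Let h_cvg0 : h (n.+1%:R)^-1 @[n --> \oo] --> 0.
Proof.
have pw : ((n.+1%:R)^-1 / c) `^ k @[n --> \oo] --> 0.
  have u0 : (n.+1%:R)^-1 / c @[n --> \oo] --> (0 : R).
    by rewrite -[0](mul0r c^-1); apply: cvgM; [exact: cvg_harmonic|exact: cvg_cst].
  have /cvg_at_rightP := powR_cvg0 k0; apply; split => // n.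
  by rewrite divr_gt0.
apply: (@squeeze_cvgr _ _ _ _ (fun=> 0) (fun n => K * c * ((n.+1%:R)^-1 / c) `^ k)).
- apply: nearW => n; rewrite h_ge0/= ler_piMr//.
    by rewrite !mulr_ge0 ?powR_ge0// ltW.
  by rewrite expR_le1 oppr_le0 divr_ge0// ltW.
- exact: cvg_cst.
- rewrite -[X in _ --> X](mulr0 (K * c)); apply: cvgM; [exact: cvg_cst|exact: pw].
Qed.

(* From [ln (y / 2k) < y / 2k] one gets [y ^ k <= (2k) ^ k * exp (y / 2)]. *)
Let h_le_inv (x : R) : 0 < x -> h x <= K * c * expR (k * ln (2 * k)) * (2 * c) * x^-1.
Proof.
move=> x0; rewrite /h; set y := x / c.
have y0 : 0 < y by rewrite divr_gt0.
have k20 : 0 < 2 * k by rewrite mulr_gt0.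
have yk : y `^ k * expR (- y) <= expR (k * ln (2 * k)) * (2 / y).
  have -> : y `^ k = expR (k * ln y) by rewrite /powR gt_eqF.
  have l : ln y < y / (2 * k) + ln (2 * k).
    have := ln_sublinear (divr_gt0 y0 k20).
    by rewrite ln_div ?posrE// => ?; rewrite -ltrBlDr.
  rewrite -expRD.
  apply: (@le_trans _ _ (expR (k * ln (2 * k)) * expR (- (y / 2)))).
    rewrite -expRD ler_expR -lerBrDr opprK -addrA.
    apply: (@le_trans _ _ (k * (y / (2 * k) + ln (2 * k)))).
      by rewrite ler_pM2l// ltW.
    rewrite le_eqVlt; apply/orP; left; apply/eqP; field.
    by rewrite gt_eqF.
  rewrite ler_pM2l ?expR_gt0// expRN -[leRHS]invrK invf_div lef_pV2 ?posrE ?expR_gt0//; last first.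
    by rewrite divr_gt0.
  by apply: le_trans (expR_ge1Dx _); rewrite lerDr.
rewrite -mulrA; apply: le_trans (ler_wpM2l _ yk) _; first by rewrite mulr_ge0// ltW.
rewrite le_eqVlt; apply/orP; left; apply/eqP; rewrite /y; field.
by rewrite !gt_eqF.
Qed.

Let h_cvgy : h n.+1%:R @[n --> \oo] --> 0.
Proof.
set C := K * c * expR (k * ln (2 * k)) * (2 * c).
apply: (@squeeze_cvgr _ _ _ _ (fun=> 0) (fun n => C * (n.+1%:R)^-1)).
- by apply: nearW => n; rewrite h_ge0/=; exact: h_le_inv.
- exact: cvg_cst.
- rewrite -[X in _ --> X](mulr0 C); apply: cvgM; [exact: cvg_cst|exact: cvg_harmonic].
Qed.

(** The shift to [n.+2] keeps the interval non-degenerate at [n = 0]. *)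
Let F (n : nat) : set R := `[(n.+2%:R)^-1, n.+2%:R]%classic.

Let F_lt n : (n.+2%:R)^-1 < n.+2%:R :> R.
Proof. by rewrite (@lt_le_trans _ _ 1)// ?invf_lt1// ?ler1n// ltr1n. Qed.

Let F_nondecreasing : nondecreasing_seq F.
Proof.
move=> m n mn; rewrite subsetEset => x; rewrite /F/= !in_itv/= => /andP[mx xm].
rewrite (le_trans _ mx)/=; last by rewrite lef_pV2 ?posrE// ler_nat.
by rewrite (le_trans xm)// ler_nat.
Qed.

Let bigcup_F : \bigcup_n F n = `]0, +oo[%classic.
Proof.
apply/seteqP; split=> [x [n _]|x]/=; rewrite /F/= ?in_itv/= ?andbT.
  by case/andP => nx _; exact: lt_le_trans nx.
move=> x0.
pose n := Num.truncn (Num.max x x^-1).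
have xn : Num.max x x^-1 <= n.+1%:R by rewrite ltW// truncnS_gt.
exists n => //; rewrite /F/= in_itv/=.
move: xn; rewrite ge_max => /andP[xn xVn]; apply/andP; split.
  by rewrite -[leRHS]invrK lef_pV2 ?posrE ?invr_gt0// (le_trans xVn)// ler_nat.
by rewrite (le_trans xn)// ler_nat.
Qed.

Variable nu : probability (measurableTypeR R) R.
Hypothesis nuE : forall A : set R, measurable A -> nu A = gamma_prob k c A.

Let integrable_pdf : leb.-integrable setT (EFin \o gamma_pdf k c).
Proof.
exact: (@density_integrable _ _ _ leb nu _ measurable_gamma_pdf gamma_pdf_ge0 nuE).
Qed.

Let mF n : measurable (F n : set (measurableTypeR R)). Proof. exact: measurable_itv. Qed.

Let xpdf (x : R) := x * gamma_pdf k c x.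

Let xpdf_patch : xpdf = (fun x => x * q x) \_ `]0, +oo[%classic.
Proof.
apply/funext => x; rewrite /xpdf /gamma_pdf !patchE.
by case: ifPn => // _; rewrite mulr0.
Qed.

Let xpdf_ge0 x : 0 <= xpdf x.
Proof.
rewrite xpdf_patch patchE; case: ifPn => //; rewrite inE/= in_itv/= andbT => x0.
by rewrite mulr_ge0// ltW.
Qed.

Let measurable_xpdf : measurable_fun setT xpdf.
Proof. by apply: measurable_funM => //; exact: measurable_gamma_pdf. Qed.

(** The mass is controlled through the probability [nu], not by evaluating the Gamma integral. *)
Let integral_pdf_F n : (\int[leb]_(x in F n) (gamma_pdf k c x)%:E <= 1)%E.
Proof.
by have := nuE (mF n); rewrite /gamma_prob => <-; apply: probability_le1; exact: mF.
Qed.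

(** The identity on [F n] with [phi = 1] expresses the truncated mean by the truncated mass and two
    boundary terms; the one at [n.+2%:R] has a favourable sign and is dropped. *)
Let integral_xpdf_F n :
  (\int[leb]_(x in F n) (xpdf x)%:E <= (c * k + c * h (n.+2%:R)^-1)%:E)%E.
Proof.
have ip : leb.-integrable (F n) (EFin \o gamma_pdf k c).
  by apply: (integrableS measurableT) => //; exact: mF.
have ix : leb.-integrable (F n) (EFin \o xpdf).
  have h1 : leb.-integrable (F n) (fun x => (n.+2%:R)%:E * (gamma_pdf k c x)%:E)%E.
    by apply: integrableZl => //; exact: mF.
  apply: (@le_integrable_EFin _ (measurableTypeR R) R leb (F n) (mF n) _
    (fun x => n.+2%:R * gamma_pdf k c x)) => //.
    exact: measurable_funTS.
  move=> x Fx; rewrite ger0_norm//; apply: ler_wpM2r; first exact: gamma_pdf_ge0.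
  by move: Fx; rewrite /F/= in_itv/= => /andP[].
have s0 : 0 < (n.+2%:R)^-1 :> R by [].
have c1 (x : R) : is_derive x (1 : R) (fun=> 1 : R) ((fun=> 0) x) by exact: is_derive_cst.
have c0' : continuous (fun _ : R => 0 : R) by exact: cst_continuous.
have := integral_stein_itv s0 (F_lt n) c1 c0'.
rewrite -/(F n) [X in X = _](_ : _ =
  k%:E * \int[leb]_(x in F n) (gamma_pdf k c x)%:E -
  c^-1%:E * \int[leb]_(x in F n) (xpdf x)%:E)%E; last first.
  rewrite -(integralZl (mF n) ip) -(integralZl (mF n) ix).
  rewrite -(integralB (mF n) (integrableZl (mF n) k ip) (integrableZl (mF n) c^-1 ix)).
  apply: eq_integral => x _; rewrite -!EFinM -EFinB; congr EFin.
  by rewrite /xpdf; field; rewrite gt_eqF.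
rewrite !mulr1.
have := integral_pdf_F n.
rewrite -(fineK (integrable_fin_num (mF n) ip)) -(fineK (integrable_fin_num (mF n) ix)).
set I := fine _; set J := fine _.
rewrite -!EFinM -EFinB !lee_fin => I1 [E].
have Jc : J = c * k * I - c * (h n.+2%:R - h (n.+2%:R)^-1).
  by rewrite -E; field; rewrite gt_eqF.
have a1 : c * k * I <= c * k by rewrite ler_piMr// mulr_ge0// ltW.
have a2 : 0 <= c * h n.+2%:R by rewrite mulr_ge0// ltW.
by rewrite Jc mulrBr; lra.
Qed.

Lemma integrable_gamma : nu.-integrable setT (EFin \o (fun x : R => x)).
Proof.
apply/(@integrable_density _ _ _ leb nu _ measurable_gamma_pdf gamma_pdf_ge0 nuE) => //.
apply/integrableP; split; first exact/measurable_EFinP.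
rewrite [X in (X < _)%E](_ : _ = \int[leb]_x (xpdf x)%:E)%E; last first.
  by apply: eq_integral => x _ /=; rewrite ger0_norm//; exact: xpdf_ge0.
have -> : (\int[leb]_x (xpdf x)%:E = \int[leb]_(x in \bigcup_n F n) (xpdf x)%:E)%E.
  rewrite bigcup_F [RHS]integral_mkcond/=; apply: eq_integral => x _.
  by rewrite patchE; case: ifPn => // nx; rewrite xpdf_patch patchE (negbTE nx).
have mX n : measurable_fun (F n : set (measurableTypeR R)) (EFin \o xpdf).
  by apply/measurable_EFinP; exact: measurable_funTS.
have X0 i x : F i x -> (0 <= (EFin \o xpdf) x)%E by rewrite /= lee_fin.
have cv := @ge0_nondecreasing_set_cvg_integral _ (measurableTypeR R) _ F (EFin \o xpdf) leb
  F_nondecreasing mF mX X0.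
rewrite -(cvg_lim _ cv)//.
have cB : (c * k + c * h (n.+2%:R)^-1)%:E @[n --> \oo] --> (c * k + c * 0)%:E.
  apply: cvg_EFin; first exact: nearW.
  apply: cvgD; first exact: cvg_cst.
  apply: cvgM; first exact: cvg_cst.
  by rewrite (cvg_shiftS (fun n => h (n.+1%:R)^-1)).
apply: (@le_lt_trans _ _ (c * k + c * 0)%:E); last exact: ltry.
rewrite -(cvg_lim _ cB)//; apply: lee_lim.
- by apply/cvg_ex; eexists; exact: cv.
- by apply/cvg_ex; eexists; exact: cB.
- by apply: nearW => n; exact: integral_xpdf_F.
Qed.

(* The integrand times the density is the derivative of [h * phi], which vanishes at both ends. *)
Lemma gamma_stein (phi dphi : R -> R) (M : R) :
  (forall x, is_derive x (1 : R) phi (dphi x)) -> continuous dphi ->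
  (forall x, `|phi x| <= M) -> (forall x, `|dphi x| <= M) ->
  \int[nu]_x (x * (phi x - c * dphi x)) = c * k * \int[nu]_x phi x.
Proof.
move=> Dphi cdphi phiM dphiM.
have cphi : continuous phi.
  by move=> x; apply: differentiable_continuous; apply/derivable1_diffP; case: (Dphi x).
have mphi : measurable_fun setT phi by exact: continuous_measurable_fun.
have mdphi : measurable_fun setT dphi by exact: continuous_measurable_fun.
pose Phi x := (k - x / c) * phi x + x * dphi x.
have iphi : nu.-integrable setT (EFin \o phi).
  exact: (@bounded_integrable _ (measurableTypeR R) R nu phi M mphi phiM).
have mpd : measurable_fun setT (fun x => phi x - c * dphi x).
  by apply: measurable_funB => //; exact: measurable_funM.
have ix : nu.-integrable setT (EFin \o (fun x => x * (phi x - c * dphi x))).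
  apply: (@integrable_mulr_bounded _ (measurableTypeR R) R nu id _ (M + c * M)) => //.
    exact: integrable_gamma.
  move=> x; rewrite (le_trans (ler_normB _ _))// lerD// normrM gtr0_norm//.
  by rewrite ler_pM2l.
(* The integral of [Phi] is [c^-1] times the difference of the two sides of the claim, so it remains
   to show that it vanishes. *)
have PhiE : Phi = (fun x => k * phi x - c^-1 * (x * (phi x - c * dphi x))).
  by apply/funext => x; rewrite /Phi; field; rewrite gt_eqF.
have iPhi : nu.-integrable setT (EFin \o Phi).
  rewrite PhiE; have := integrableB measurableT (integrableZl measurableT k iphi)
    (integrableZl measurableT c^-1 ix).
  by apply: eq_integrable => // x _ /=; rewrite EFinB !EFinM.
suff : \int[nu]_x Phi x = 0.
  rewrite PhiE RintegralB//; last 2 first.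
  - by have := integrableZl measurableT k iphi; apply: eq_integrable.
  - by have := integrableZl measurableT c^-1 ix; apply: eq_integrable.
  rewrite !RintegralZl// => /eqP; rewrite subr_eq0 => /eqP E.
  by rewrite -mulrA E mulrA mulfV ?mul1r// gt_eqF.
have mPhi : measurable_fun setT Phi by have /integrableP[/measurable_EFinP] := iPhi.
rewrite (@Rintegral_density _ _ _ leb nu _ measurable_gamma_pdf gamma_pdf_ge0 nuE)//.
have iPp := (@integrable_density _ _ _ leb nu _ measurable_gamma_pdf gamma_pdf_ge0 nuE _ mPhi).1
  iPhi.
have mPp : measurable_fun setT (fun x => Phi x * gamma_pdf k c x).
  by apply: measurable_funM => //; exact: measurable_gamma_pdf.
pose f_ n := (fun x => Phi x * gamma_pdf k c x) \_ (F n).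
have cv : \int[leb]_x f_ n x @[n --> \oo] --> \int[leb]_x (Phi x * gamma_pdf k c x).
  apply: (@dominated_cvg_Rintegral _ (measurableTypeR R) _ leb setT measurableT f_ _
    (fun x => `|Phi x * gamma_pdf k c x|)).
  - move=> n; apply: (@measurable_restrictT _ _ (measurableTypeR R) R (F n) _ (mF n)).1.
    have mPp' : measurable_fun [set: measurableTypeR R] (fun x => Phi x * gamma_pdf k c x) := mPp.
    exact: (@measurable_funTS _ _ (measurableTypeR R) R (F n) _ mPp').
  - move=> x _; have [x0|x0] := ltP 0 x.
      have [N _ FNx] : (\bigcup_n F n) x by rewrite bigcup_F/= in_itv/= x0.
      apply: cvg_near_cst; exists N => // n /= Nn; rewrite /f_ patchE mem_set//.
      by have := F_nondecreasing Nn; rewrite subsetEset; apply.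
    have p0 : gamma_pdf k c x = 0.
      by rewrite /gamma_pdf patchE memNset//= in_itv/= andbT ltNge x0.
    rewrite p0 mulr0; apply: cvg_near_cst; apply: nearW => n.
    by rewrite /f_ patchE p0 mulr0; case: ifP.
  - exact: integrable_norm.
  - by move=> n x _; rewrite /f_ patchE; case: ifP => // _; rewrite normr0.
have fE n : \int[leb]_x f_ n x = h n.+2%:R * phi n.+2%:R - h (n.+2%:R)^-1 * phi (n.+2%:R)^-1.
  have s0 : 0 < (n.+2%:R)^-1 :> R by [].
  rewrite /f_ -Rintegral_mkcond /Rintegral.
  by rewrite (integral_stein_itv s0 (F_lt n) Dphi cdphi).
have hphi (u v : nat -> R) : u n @[n --> \oo] --> 0 -> u n * phi (v n) @[n --> \oo] --> 0.
  move=> u0; apply/cvgr0Pnorm_le => e e0.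
  have M0 : 0 <= M by exact: le_trans (phiM 0).
  (* [M] itself may be [0] and could not serve as a divisor. *)
  have M1 : 0 < M + 1 by rewrite ltr_wpDl.
  have /cvgr0Pnorm_le/(_ _ (divr_gt0 e0 M1)) := u0.
  apply: filterS => n un; rewrite normrM.
  rewrite (le_trans (ler_pM _ _ un (le_trans (phiM (v n)) _ : _ <= M + 1)))//.
    by rewrite lerDl.
  by rewrite divfK// gt_eqF.
have cv0 : \int[leb]_x f_ n x @[n --> \oo] --> 0.
  rewrite (eq_cvg _ _ fE).
  suff : h n.+2%:R * phi n.+2%:R - h (n.+2%:R)^-1 * phi (n.+2%:R)^-1 @[n --> \oo] --> 0 - 0.
    by rewrite subr0.
  apply: cvgB; apply: hphi.
  - by rewrite (cvg_shiftS (fun n => h n.+1%:R)).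
  - by rewrite (cvg_shiftS (fun n => h (n.+1%:R)^-1)).
exact: cvg_unique cv cv0.
Qed.

End gamma_law.

(** * Independence *)

Definition mfun_of d d' (T : measurableType d) (T' : measurableType d')
    (f : T -> T') (mf : measurable_fun setT f) : {mfun T >-> T'} :=
  MeasurableFun.Pack (MeasurableFun.Class (isMeasurableFun.Build _ _ _ _ _ mf)).

Section integral_law.
Context d d' (T : measurableType d) (T' : measurableType d') (R : realType)
  (P : probability T R) (X : {mfun T >-> T'}).

Lemma integrable_distribution (f : T' -> R) : measurable_fun setT f ->
  P.-integrable setT (EFin \o (f \o X)) <-> (distribution P X).-integrable setT (EFin \o f).
Proof.
move=> mf; split=> [intf|/integrableP[_]].
  apply: integrable_pushforward => //; first exact/measurable_EFinP.
rewrite (@ge0_integral_distribution _ _ _ _ _ P X (fun x => `|(f x)%:E|%E))//; last first.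
  by apply: measurableT_comp => //; exact/measurable_EFinP.
move=> fin; apply/integrableP; split => //.
by apply/measurable_EFinP; exact: measurableT_comp.
Qed.

Lemma Rintegral_distribution (f : T' -> R) : measurable_fun setT f ->
  P.-integrable setT (EFin \o (f \o X)) ->
  \int[distribution P X]_x f x = \int[P]_w f (X w).
Proof.
move=> mf intf; rewrite /Rintegral integral_distribution//.
exact/measurable_EFinP.
Qed.

End integral_law.

Section independence.
Context d (T : measurableType d) (R : realType) (P : probability T R).

Definition independent2 (X Y : T -> R) := forall A B : set R,
  measurable A -> measurable B ->
  P (X @^-1` A `&` Y @^-1` B) = (P (X @^-1` A) * P (Y @^-1` B))%E.

(** Independence says that the law of the pair agrees with the product measure on rectangles;
    uniqueness of the product measure extends this to all measurable sets, and Fubini's theorem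
    applies. *)
Lemma independent2_integral (X Y : {RV P >-> R}) (f : R * R -> R) :
  independent2 X Y -> measurable_fun setT f ->
  P.-integrable setT (EFin \o (fun w => f (X w, Y w))) ->
  (\int[P]_w (f (X w, Y w))%:E =
   \int[distribution P Y]_y \int[distribution P X]_x (f (x, y))%:E)%E.
Proof.
move=> XY mf intf.
have mZ : measurable_fun setT (fun w => (X w, Y w)) by exact: measurable_fun_pair.
pose Z := mfun_of mZ.
have ZE (A : set (R * R)) : measurable A ->
    (distribution P X \x distribution P Y)%E A = distribution P Z A.
  apply: product_measure_unique => B C mB mC.
  by rewrite /= /distribution /pushforward -XY.
have mEf : measurable_fun setT (EFin \o f) by exact/measurable_EFinP.
have intZ : (distribution P Z).-integrable setT (EFin \o f).
  exact/(integrable_distribution P Z mf).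
have intp : (distribution P X \x distribution P Y)%E.-integrable setT (EFin \o f).
  apply/integrableP; split => //.
  rewrite (eq_measure_integral (distribution P Z)); last by move=> A mA _; exact: ZE.
  by have /integrableP[] := intZ.
transitivity (\int[distribution P Z]_z (f z)%:E)%E.
  by rewrite integral_distribution.
rewrite -(eq_measure_integral _ (fun A mA _ => ZE A mA)).
by rewrite -(integral21_prod_meas1 intp).
Qed.

End independence.

Section mutual_independence.
Context d (T : measurableType d) (R : realType) (P : probability T R).
Context (I : finType) (X : I -> {RV P >-> R}) (indepX : mutually_independent P X).
Variable k : I.

Let cyl (B : I -> set R) : set T := \bigcap_(i in [set` [set~ k]%SET]) X i @^-1` B i.
(** A pi-system generating the sigma-algebra of the variables [X i] with [i != k]. *)
Let G : set (set T) := [set C | exists2 B, (forall i, measurable (B i)) & C = cyl B].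

Let cyl_measurable B : (forall i, measurable (B i)) -> measurable (cyl B).
Proof.
move=> mB; apply: fin_bigcap_measurable => [|i _]; first exact: finite_finset.
exact: measurable_funPTI.
Qed.

Let setIG : setI_closed G.
Proof.
move=> _ _ [B mB ->] [C mC ->]; exists (fun i => B i `&` C i).
  by move=> i; exact: measurableI.
apply/seteqP; split=> [x [xB xC] i ki|x xBC].
  by split; [exact: xB|exact: xC].
by split=> i ki; have [] := xBC i ki.
Qed.

(** Pi-lambda argument: the measurable events independent of [XA] form a lambda-system, and for a
    cylinder the claim is mutual independence over all indices with [A] put at index [k].
    Measurability is carried along because the complement step needs it. *)
Let indep_G (A : set R) : measurable A -> forall C, <<s G >> C ->
  measurable C /\ P (X k @^-1` A `&` C) = (P (X k @^-1` A) * P C)%E.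
Proof.
move=> mA; set XA := X k @^-1` A.
have mXA : measurable XA by exact: measurable_funPTI.
pose H : set (set T) := [set C | measurable C /\ P (XA `&` C) = (P XA * P C)%E].
suff : <<s G >> `<=` H by move=> + C => /(_ C).
apply: lambda_system_subset => //.
- apply/dynkin_lambda_system; split.
  + by split => //; rewrite setIT probability_setT mule1.
  + move=> C [mC CE]; split; first exact: measurableC.
    have DE : P (XA `\` C) = (P XA - P (XA `&` C))%E.
      by apply: measureD => //; rewrite ltey_eq fin_num_measure.
    rewrite -setDE DE CE probability_setC//.
    have /fineK <- : P XA \is a fin_num by exact: fin_num_measure.
    have /fineK <- : P C \is a fin_num by exact: fin_num_measure.
    by rewrite muleBr ?mule1.
  + move=> C tC HC; have mC n : measurable (C n) by have [] := HC n.
    split; first exact: bigcupT_measurable.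
    rewrite setI_bigcupr measure_bigcup//; last 2 first.
    * by move=> n _; exact: measurableI.
    * exact: trivIset_setIl.
    rewrite measure_bigcup//.
    have /fineK <- : P XA \is a fin_num by exact: fin_num_measure.
    rewrite -nneseriesZl//; apply: eq_eseriesr => n _.
    by rewrite fineK ?fin_num_measure//; have [] := HC n.
- move=> _ [B mB ->]; split; first exact: cyl_measurable.
  pose B' i := if i == k then A else B i.
  have mB' i : measurable (B' i) by rewrite /B'; case: ifP.
  have cylE : cyl B = \bigcap_(i in [set` [set~ k]%SET]) X i @^-1` B' i.
    apply: eq_bigcapr => i; rewrite /= in_setC1 => ik.
    by rewrite /B' (negbTE ik).
  have -> : XA `&` cyl B = \bigcap_(i in [set` [set: I]%SET]) X i @^-1` B' i.
    rewrite cylE; apply/seteqP; split=> [x [xA xB] i _|x xB'].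
      have [->|ik] := eqVneq i k; first by rewrite /B' eqxx.
      by apply: xB; rewrite /= in_setC1.
    split=> [|i _]; last by apply: xB'; rewrite /= finset.in_setT.
    have := xB' k; rewrite /= finset.in_setT => /(_ isT).
    by rewrite /B' eqxx.
  rewrite cylE !indepX// (bigD1 k) ?finset.in_setT//=; congr (_ * _)%E.
    by rewrite /B' eqxx.
  by apply: eq_bigl => i; rewrite !inE.
Qed.

(** Taking [g_sigma_algebraType G] as the measurable structure on the sample space, the usual
    closure rules show that the sum is measurable for [<<s G >>], and its preimages fall under
    [indep_G]. *)
Lemma independent2_sum (a : I -> R) (b : R) :
  independent2 P (X k) (fun w => \sum_(i | i != k) a i * X i w + b).
Proof.
move=> A B mA mB.
set S := fun w => _.
suff mS : <<s G >> (S @^-1` B) by have [_ ->] := indep_G mA mS.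
have mX i : i != k ->
    measurable_fun [set: g_sigma_algebraType G] (X i : g_sigma_algebraType G -> R).
  move=> ik _ C mC; rewrite setTI; apply: sub_gen_smallest.
  exists (fun j => if j == i then C else setT).
    by move=> j; case: ifP.
  apply/seteqP; split=> [x xC j _|x /(_ i)] /=.
    by case: eqP => [->|].
  by rewrite in_setC1 eqxx => /(_ ik).
have mS : measurable_fun [set: g_sigma_algebraType G] (S : g_sigma_algebraType G -> R).
  apply: measurable_funD => //.
  under eq_fun do rewrite big_mkcond/=.
  apply: measurable_sum => i /=; have [_|ik] := eqVneq i k; first exact: measurable_cst.
  exact: measurable_funM (measurable_cst _) (mX i ik).
by have := mS measurableT B mB; rewrite setTI.
Qed.

End mutual_independence.

(** * The Stein identity of linear combinations of gamma variables *)

Section gamma_random_variable.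
Context d (T : measurableType d) (R : realType) (P : probability T R).
Context (X : {RV P >-> R}) (k c : R) (k0 : 0 < k) (c0 : 0 < c).
Hypothesis gammaX : gamma_distributed P X k c.

(* [lebesgue_measure] lives on [measurableTypeR R], which has the measurable sets of [R]
   but another display. *)
Let mX : measurable_fun setT (X : T -> measurableTypeR R) := @measurable_funPT _ _ _ _ X.
Let X' := mfun_of mX.
Let nu : probability (measurableTypeR R) R := distribution P X'.
Let nuE (A : set R) : measurable A -> nu A = gamma_prob k c A.
Proof. exact: gammaX. Qed.

Lemma gamma_distributed_integrable : P.-integrable setT (EFin \o X).
Proof.
apply/(integrable_distribution P X' (f := fun x : R => x)); first exact: measurable_id.
exact: (@integrable_gamma R k c k0 c0 nu nuE).
Qed.

Lemma gamma_distributed_stein (phi dphi : R -> R) (M : R) :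
  (forall x, is_derive x (1 : R) phi (dphi x)) -> continuous dphi ->
  (forall x, `|phi x| <= M) -> (forall x, `|dphi x| <= M) ->
  \int[distribution P X]_x (x * (phi x - c * dphi x)) =
  c * k * \int[distribution P X]_x phi x.
Proof.
move=> Dphi cdphi phiM dphiM.
have cphi : continuous phi.
  by move=> x; apply: differentiable_continuous; apply/derivable1_diffP; case: (Dphi x).
have mphi : measurable_fun setT phi by exact: continuous_measurable_fun.
have mdphi : measurable_fun setT dphi by exact: continuous_measurable_fun.
have mpd : measurable_fun setT (fun x => phi x - c * dphi x).
  by apply: measurable_funB => //; exact: measurable_funM.
have mxpd : measurable_fun setT (fun x : R => x * (phi x - c * dphi x)) by exact: measurable_funM.
have iphi : P.-integrable setT (EFin \o (phi \o X)).
  by apply: (@bounded_integrable _ _ _ _ _ M) => [|w]; [exact: measurableT_comp|exact: phiM].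
have ixpd : P.-integrable setT (EFin \o ((fun x => x * (phi x - c * dphi x)) \o X)).
  apply: (@integrable_mulr_bounded _ _ _ _ X (fun w => phi (X w) - c * dphi (X w)) (M + c * M)).
  - exact: gamma_distributed_integrable.
  - exact: (measurableT_comp mpd).
  - move=> w; rewrite (le_trans (ler_normB _ _))// lerD// normrM gtr0_norm//.
    by rewrite ler_pM2l.
rewrite (Rintegral_distribution mxpd ixpd) (Rintegral_distribution mphi iphi).
have := gamma_stein k0 c0 nuE Dphi cdphi phiM dphiM.
have -> := @Rintegral_distribution _ _ _ _ _ P X' _ mxpd ixpd.
by have -> := @Rintegral_distribution _ _ _ _ _ P X' _ mphi iphi.
Qed.

End gamma_random_variable.

(** Operator form of the integrand of the theorem; [stein_integrandE] expands it into elementary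
    symmetric polynomials. *)
Definition stein_integrand (R : realType) (n : nat) (wt a : 'I_n -> R) (f : R -> R) (y : R) : R :=
  y * diffop (symbol_poly a) f y +
  \sum_(k < n) wt k * (diffop (symbol_poly a) f y - diffop (symbol_poly (drop_entry k a)) f y).

Lemma symbol_poly_drop (R : realType) (n : nat) (a : 'I_n -> R) (k : 'I_n) :
  symbol_poly a = (1 - a k *: 'X) * symbol_poly (drop_entry k a).
Proof. by rewrite /symbol_poly (bigD1_ord k). Qed.

Section gamma_combination.
Context d (T : measurableType d) (R : realType) (P : probability T R).
Context (n : nat) (X : 'I_n -> {RV P >-> R}) (k c a : 'I_n -> R).
Hypotheses (k0 : forall i, 0 < k i) (c0 : forall i, 0 < c i).
Hypothesis gammaX : forall i, gamma_distributed P (X i) (k i) (c i).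
Hypothesis indepX : mutually_independent P X.

Let F w := \sum_(i < n) a i * (X i w - k i * c i).

Let mF : measurable_fun setT F.
Proof.
by apply: measurable_sum => i; apply: measurable_funM => //; exact: measurable_funB.
Qed.

Let smooth_bound (f : R -> R) : smooth_bounded f ->
  exists M, (forall x, `|f x| <= M) /\ (forall x, `|derive1 f x| <= M).
Proof.
move=> [_ bf]; have [M hM] := bf 0%N; have [N hN] := bf 1%N.
exists (Num.max M N); split=> x; rewrite le_max.
  by have := hM x; rewrite derive1n0 => ->.
by have := hN x; rewrite derive1n1 => ->; rewrite orbT.
Qed.

Let smooth_bounded_measurable (f : R -> R) : smooth_bounded f -> measurable_fun setT f.
Proof. by move=> /smooth_bounded_continuous; exact: continuous_measurable_fun. Qed.

Let integrable_F (f : R -> R) : smooth_bounded f ->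
  P.-integrable setT (EFin \o (fun w => f (F w))).
Proof.
move=> sf; have [M [fM _]] := smooth_bound sf.
apply: (@bounded_integrable _ _ _ _ _ M) => //.
by apply: measurableT_comp => //; exact: smooth_bounded_measurable.
Qed.

Let integrable_XF i (f : R -> R) : smooth_bounded f ->
  P.-integrable setT (EFin \o (fun w => X i w * f (F w))).
Proof.
move=> sf; have [M [fM _]] := smooth_bound sf.
apply: (@integrable_mulr_bounded _ _ _ _ (X i) (fun w => f (F w)) M) => //.
  exact: gamma_distributed_integrable (gammaX i).
by apply: measurableT_comp => //; exact: smooth_bounded_measurable.
Qed.

(* Conditionally on the other variables, [F] is an affine function of [X j]. *)
Let stein_coordinate (j : 'I_n) (f : R -> R) : smooth_bounded f ->
  \int[P]_w (X j w * (f (F w) - (c j * a j) * derive1 f (F w))) =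
  c j * k j * \int[P]_w f (F w).
Proof.
move=> sf; have sdf := smooth_bounded_derive1 sf.
have [M [fM dfM]] := smooth_bound sf.
pose b := - \sum_(i < n) a i * (k i * c i).
pose S w := \sum_(i | i != j) a i * X i w + b.
have mS : measurable_fun setT S.
  apply: measurable_funD => //; under eq_fun do rewrite big_mkcond/=.
  apply: measurable_sum => i /=; have [_|ij] := eqVneq i j; first exact: measurable_cst.
  exact: measurable_funM.
have FE w : F w = a j * X j w + S w.
  rewrite /F /S /b addrA.
  have -> : a j * X j w + \sum_(i | i != j) a i * X i w = \sum_i a i * X i w.
    by rewrite [RHS](bigD1 j).
  rewrite -sumrB.
  by apply: eq_bigr => i _; rewrite mulrBr.
pose SRV : {RV P >-> R} := mfun_of mS.
have ind : independent2 P (X j) SRV by exact: independent2_sum.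
have maff : measurable_fun setT (fun z : R * R => a j * z.1 + z.2).
  apply: measurable_funD; last exact: measurable_snd.
  by apply: measurable_funM => //; exact: measurable_fst.
have mf : measurable_fun setT (fun z : R * R => f (a j * z.1 + z.2)).
  by apply: measurableT_comp => //; exact: smooth_bounded_measurable.
have mdf : measurable_fun setT (fun z : R * R => derive1 f (a j * z.1 + z.2)).
  by apply: measurableT_comp => //; exact: smooth_bounded_measurable.
pose f1 (z : R * R) := z.1 * (f (a j * z.1 + z.2) - c j * (a j * derive1 f (a j * z.1 + z.2))).
pose f2 (z : R * R) := c j * k j * f (a j * z.1 + z.2).
have mf1 : measurable_fun setT f1.
  apply: measurable_funM; first exact: measurable_fst.
  by apply: measurable_funB => //; apply: measurable_funM => //; apply: measurable_funM.
have mf2 : measurable_fun setT f2 by apply: measurable_funM.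
have f1E w : f1 (X j w, SRV w) = X j w * (f (F w) - (c j * a j) * derive1 f (F w)).
  by rewrite /f1/= -FE mulrA.
have f2E w : f2 (X j w, SRV w) = c j * k j * f (F w) by rewrite /f2/= -FE.
have if1 : P.-integrable setT (EFin \o (fun w => f1 (X j w, SRV w))).
  have := integrable_XF j (smooth_bounded_lin 1 (- (c j * a j)) sf sdf).
  by apply: eq_integrable => // w _ /=; rewrite f1E mul1r mulNr.
have if2 : P.-integrable setT (EFin \o (fun w => f2 (X j w, SRV w))).
  have := integrableZl measurableT (c j * k j) (integrable_F sf).
  by apply: eq_integrable => // w _ /=; rewrite f2E EFinM.
rewrite -RintegralZl//; last exact: integrable_F.
rewrite -(eq_Rintegral _ (fun w _ => f1E w)) -(eq_Rintegral _ (fun w _ => f2E w)).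
rewrite /Rintegral (independent2_integral ind mf1 if1) (independent2_integral ind mf2 if2).
congr fine; apply: eq_integral => s _.
(* With the other variables frozen at [s], the gamma identity is applied to [x |-> f (a j * x + s)];
   the chain rule turns the scale [c j] into [c j * a j]. *)
have Daff x : is_derive x (1 : R) (fun x => f (a j * x + s)) (a j * derive1 f (a j * x + s)).
  have dl : is_derive x (1 : R) (fun x => a j * x + s) (a j).
    have := is_deriveD (is_deriveZ (a j) (is_derive_id x (1 : R))) (is_derive_cst s x 1).
    by rewrite addr0 [_ *: _]mulr1.
  have dfs : is_derive (a j * x + s) (1 : R) f (derive1 f (a j * x + s)).
    by apply: smooth_is_derive; case: sf.
  have := @is_derive1_comp _ f (fun x => a j * x + s) x _ _ dfs dl.
  by rewrite mulrC.
have cdf : continuous (fun x => a j * derive1 f (a j * x + s)).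
  move=> x; apply: cvgM; first exact: cvg_cst.
  have := smooth_bounded_continuous sdf (x := a j * x + s).
  apply: cvg_comp; apply: cvgD; last exact: cvg_cst.
  by apply: cvgM; [exact: cvg_cst|exact: cvg_id].
(* [gamma_distributed_stein] takes a single bound for the function and its derivative. *)
have bM : `|a j| * M + M >= 0.
  by rewrite addr_ge0 ?mulr_ge0 ?(le_trans _ (fM 0)).
have b1 x : `|f (a j * x + s)| <= `|a j| * M + M.
  by rewrite (le_trans (fM _))// lerDr mulr_ge0// (le_trans _ (fM 0)).
have b2 x : `|a j * derive1 f (a j * x + s)| <= `|a j| * M + M.
  by rewrite normrM ler_wpDr ?(le_trans _ (fM 0))// ler_wpM2l.
have E := gamma_distributed_stein (k0 j) (c0 j) (gammaX j) Daff cdf b1 b2.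
have ms : measurable_fun setT (fun x : R => (x, s)) by exact: measurable_fun_pair.
have iX : (distribution P (X j)).-integrable setT (EFin \o (fun x : R => x)).
  by apply/integrable_distribution => //; exact: gamma_distributed_integrable (gammaX j).
have i1 : (distribution P (X j)).-integrable setT (EFin \o (fun x => f1 (x, s))).
  apply: (@integrable_mulr_bounded _ _ _ (distribution P (X j)) (fun x : R => x)
    (fun x => f (a j * x + s) - c j * (a j * derive1 f (a j * x + s))) (M + c j * (`|a j| * M + M))) => //.
    apply: measurable_funB; first exact: (measurableT_comp mf ms).
    apply: measurable_funM => //; apply: measurable_funM => //.
    exact: (measurableT_comp mdf ms).
  move=> x; rewrite (le_trans (ler_normB _ _))// lerD//.
  by rewrite normrM gtr0_norm// ler_pM2l.
have i2 : (distribution P (X j)).-integrable setT (EFin \o (fun x => f2 (x, s))).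
  apply: (@bounded_integrable _ _ _ _ _ (c j * k j * M)).
    exact: (measurableT_comp mf2 ms).
  by move=> x; rewrite normrM gtr0_norm ?mulr_gt0// ler_pM2l ?mulr_gt0.
have i3 : (distribution P (X j)).-integrable setT (EFin \o (fun x => f (a j * x + s))).
  by apply: (@bounded_integrable _ _ _ _ _ M) => //; exact: (measurableT_comp mf ms).
rewrite -[LHS]fineK; last exact: (integrable_fin_num measurableT i1).
rewrite -[RHS]fineK; last exact: (integrable_fin_num measurableT i2).
congr EFin; rewrite -/(Rintegral _ _ _) E -/(Rintegral _ _ _) -RintegralZl//.
Qed.

Lemma gamma_combination_stein (f : R -> R) : smooth_bounded f ->
  let wt i := a i * k i * c i in
  \int[P]_w stein_integrand wt (fun i => a i * c i) f (F w) = 0.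
Proof.
move=> sf wt; set ac := fun i => a i * c i.
set Af := diffop (symbol_poly ac) f.
pose Af_ j := diffop (symbol_poly (drop_entry j ac)) f.
have sAf : smooth_bounded Af by exact: smooth_bounded_diffop.
have sAf_ j : smooth_bounded (Af_ j) by exact: smooth_bounded_diffop.
have AfE j x : Af x = Af_ j x - (c j * a j) * derive1 (Af_ j) x.
  rewrite /Af (symbol_poly_drop ac j) diffopM_linear; last by case: sf.
  by rewrite [c j * a j]mulrC.
(* The centring of [F] contributes [- \sum_j wt j * Af], which cancels the [Af] part of the second
   sum. Each remaining summand has mean zero by [stein_coordinate] at [Af_ j]. *)
have E w : stein_integrand wt ac f (F w) =
    \sum_(j < n) (a j * (X j w * Af (F w)) - wt j * Af_ j (F w)).
  rewrite /stein_integrand -/Af {1}/F mulr_suml -big_split/=.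
  apply: eq_bigr => j _; rewrite -/(Af_ j) /wt; ring.
rewrite (eq_Rintegral _ (fun w _ => E w)).
have i1 j : P.-integrable setT (EFin \o (fun w => a j * (X j w * Af (F w)))).
  have := integrableZl measurableT (a j) (integrable_XF j sAf).
  by apply: eq_integrable => // w _ /=; rewrite EFinM.
have i2 j : P.-integrable setT (EFin \o (fun w => wt j * Af_ j (F w))).
  have := integrableZl measurableT (wt j) (integrable_F (sAf_ j)).
  by apply: eq_integrable => // w _ /=; rewrite EFinM.
have i3 j : P.-integrable setT (EFin \o (fun w => a j * (X j w * Af (F w)) - wt j * Af_ j (F w))).
  have := integrableB measurableT (i1 j) (i2 j).
  by apply: eq_integrable => // w _ /=; rewrite EFinB.
rewrite /Rintegral; under eq_integral do rewrite -sumEFin.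
rewrite integral_sum//.
rewrite big1 ?fine0// => j _.
rewrite -[LHS]fineK; last exact: (integrable_fin_num measurableT (i3 j)).
congr EFin; rewrite -/(Rintegral _ _ _) RintegralB//.
rewrite RintegralZl ?RintegralZl//; [|exact: integrable_F|exact: integrable_XF].
under eq_Rintegral do rewrite (AfE j).
by rewrite stein_coordinate// /wt; ring.
Qed.

End gamma_combination.

(** * From Schwartz functions to smooth functions with bounded derivatives *)

Section gaussian_cutoff.
Context {R : realType}.
Local Notation "f ^` ( n )" := (derive1n n f) : ring_scope.
Local Notation "f ^` ()" := (derive1 f) : ring_scope.
Implicit Types (f g h : R -> R) (p : {poly R}) (t x l : R).

Let derive1_mul f g : (forall x, derivable f x 1) -> (forall x, derivable g x 1) ->
  (fun x => f x * g x)^`() = (fun x => 1 * (f^`() x * g x) + 1 * (f x * g^`() x)).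
Proof.
move=> df dg; apply/funext => x; apply: is_derive_derive1.
have := is_deriveM (derivable_is_derive (df x)) (derivable_is_derive (dg x)).
by rewrite /GRing.scale/= !mul1r addrC [g x * _]mulrC.
Qed.

(** The product rule is iterated over all pairs of smooth factors at once, in place of the binomial
    Leibniz formula; the range [i <= n] supplies the lower orders that [derive1n_lin_upto] asks
    for. *)
Let derivable_mul_upto n : forall f g, smooth f -> smooth g ->
  forall i x, (i <= n)%N -> derivable (fun x => f x * g x)^`(i) x 1.
Proof.
elim: n => [|n IH] f g sf sg [|i] x //.
- by move=> _; apply: derivableM; [exact: (sf 0%N)|exact: (sg 0%N)].
- by move=> _; apply: derivableM; [exact: (sf 0%N)|exact: (sg 0%N)].
rewrite ltnS => ni.
have sf' := smooth_derive1 sf; have sg' := smooth_derive1 sg.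
rewrite derive1Sn derive1_mul; [|exact: (sf 0%N)|exact: (sg 0%N)].
rewrite derive1n_lin_upto.
- have := @derivableD _ _ _ (1 *: (fun x => f^`() x * g x)^`(i))
    (1 *: (fun x => f x * g^`() x)^`(i)) x 1.
  by apply; apply: derivableZ; apply: IH.
- by move=> j y ji; apply: IH => //; rewrite (leq_trans _ ni)// ltnW.
- by move=> j y ji; apply: IH => //; rewrite (leq_trans _ ni)// ltnW.
Qed.

Lemma smooth_mul f g : smooth f -> smooth g -> smooth (fun x => f x * g x).
Proof. by move=> sf sg n x; exact: (@derivable_mul_upto n). Qed.

Lemma derive1n_mulS f g n : smooth f -> smooth g ->
  (fun x => f x * g x)^`(n.+1) =
  (fun x => 1 * (fun x => f^`() x * g x)^`(n) x + 1 * (fun x => f x * g^`() x)^`(n) x).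
Proof.
move=> sf sg; rewrite derive1Sn derive1_mul; [|exact: (sf 0%N)|exact: (sg 0%N)].
by rewrite derive1n_lin//; apply: smooth_mul => //; exact: smooth_derive1.
Qed.

Lemma schwartz_mul g h : schwartz g -> smooth_bounded h -> schwartz (fun x => g x * h x).
Proof.
move=> [sg bg] [sh bh]; split; first exact: smooth_mul.
move=> k n; elim: n g h sg bg sh bh => [|n IH] g h sg bg sh bh.
  have [M gM] := bg k 0%N; have [N hN] := bh 0%N.
  exists (M * N) => x; rewrite derive1n0 mulrA normrM.
  exact: ler_pM (normr_ge0 _) (normr_ge0 _) (gM x) (hN x).
have bg' j i : exists M, forall x, `|x ^+ j * g^`()^`(i) x| <= M.
  by have [M gM] := bg j i.+1; exists M => x; rewrite -derive1Sn.
have [M1 h1] := IH g^`() h (smooth_derive1 sg) bg' sh bh.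
have [sh' bh'] := smooth_bounded_derive1 (conj sh bh).
have [M2 h2] := IH g h^`() sg bg sh' bh'.
exists (M1 + M2) => x; rewrite derive1n_mulS// !mul1r mulrDr.
exact: le_trans (ler_normD _ _) (lerD (h1 x) (h2 x)).
Qed.

Let is_derive_scale t g x l : is_derive (t * x) (1 : R) g l ->
  is_derive x (1 : R) (fun x => g (t * x)) (t * l).
Proof.
move=> dg.
have dl : is_derive x (1 : R) (fun x => t * x) t.
  by have := is_deriveZ t (is_derive_id x (1 : R)); rewrite [_ *: _]mulr1.
by have := @is_derive1_comp _ g (fun x => t * x) x _ _ dg dl; rewrite mulrC.
Qed.

Let derive1n_scale t g n : smooth g ->
  (fun x => g (t * x))^`(n) = (fun x => t ^+ n * g^`(n) (t * x)).
Proof.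
move=> sg; elim: n => [|n IH].
  by rewrite !derive1n0; apply/funext => x; rewrite expr0 mul1r.
rewrite derive1nS IH; apply/funext => x; apply: is_derive_derive1.
have := is_deriveZ (t ^+ n) (is_derive_scale (derivable_is_derive (sg n (t * x)))).
by rewrite [_ *: _]mulrA -exprSr -derive1nS.
Qed.

Let smooth_scale t g : smooth g -> smooth (fun x => g (t * x)).
Proof.
move=> sg n x; rewrite derive1n_scale//.
by have [] := is_deriveZ (t ^+ n) (is_derive_scale (derivable_is_derive (sg n (t * x)))).
Qed.

Lemma schwartz_scale t g : t != 0 -> schwartz g -> schwartz (fun x => g (t * x)).
Proof.
move=> t0 [sg bg]; split; first exact: smooth_scale.
move=> k n; have [M gM] := bg k n.
exists (`|t ^+ n / t ^+ k| * M) => x; rewrite derive1n_scale//.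
have -> : x ^+ k * (t ^+ n * g^`(n) (t * x)) = t ^+ n / t ^+ k * ((t * x) ^+ k * g^`(n) (t * x)).
  by rewrite exprMn; field; rewrite expf_neq0.
by rewrite normrM ler_wpM2l.
Qed.

Section scaled_product.
Variable t : nat -> R.
Hypotheses (t0 : t m @[m --> \oo] --> (0 : R)) (t1 : forall m, `|t m| <= 1).

(** Each derivative falling on the dilated factor brings out [t m], which tends to [0], so in the
    limit all derivatives fall on [h]; [|t m| <= 1] keeps the bounds uniform in [m]. *)
Lemma scaled_product_derive1n n : forall g h, smooth_bounded g -> smooth_bounded h ->
  (exists M, forall m x, `|(fun x => g (t m * x) * h x)^`(n) x| <= M) /\
  (forall x, (fun x => g (t m * x) * h x)^`(n) x @[m --> \oo] --> g 0 * h^`(n) x).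
Proof.
elim: n => [|n IH] g h sg sh.
  have [M gM] := sg.2 0%N; have [N hN] := sh.2 0%N.
  split=> [|x].
    exists (M * N) => m x; rewrite derive1n0 normrM.
    exact: ler_pM (normr_ge0 _) (normr_ge0 _) (gM _) (hN _).
  rewrite derive1n0; apply: cvgM; last exact: cvg_cst.
  have tx0 : t m * x @[m --> \oo] --> (0 : R).
    by rewrite -[0](mul0r x); apply: cvgM => //; exact: cvg_cst.
  by apply: continuous_cvg => //; exact: (smooth_bounded_continuous sg).
have sg' := smooth_bounded_derive1 sg; have sh' := smooth_bounded_derive1 sh.
have [[M1 b1] c1] := IH _ _ sg' sh; have [[M2 b2] c2] := IH _ _ sg sh'.
have E m x : (fun x => g (t m * x) * h x)^`(n.+1) x =
    t m * (fun x => g^`() (t m * x) * h x)^`(n) x + (fun x => g (t m * x) * h^`() x)^`(n) x.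
  have sgt : smooth (fun x => g (t m * x)) by apply: smooth_scale; exact: sg.1.
  rewrite derive1n_mulS//; last exact: sh.1.
  rewrite !mul1r; congr (_ + _).
  (* The null second term gives the scalar multiple the shape of [derive1n_lin]. *)
  have -> : (fun x => (fun x => g (t m * x))^`() x * h x) =
      (fun x => t m * (g^`() (t m * x) * h x) + 0 * (g^`() (t m * x) * h x)).
    apply/funext => y; rewrite mul0r addr0 mulrA; congr (_ * _).
    by apply: is_derive_derive1; apply: is_derive_scale; apply: smooth_is_derive; exact: sg.1.
  have sgh : smooth (fun x => g^`() (t m * x) * h x).
    by apply: smooth_mul; [apply: smooth_scale; exact: sg'.1|exact: sh.1].
  by rewrite derive1n_lin// mul0r addr0.
split=> [|x].
  exists (M1 + M2) => m x; rewrite E (le_trans (ler_normD _ _))// lerD//.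
  by rewrite normrM -[leRHS]mul1r ler_pM.
rewrite (eq_cvg _ _ (E ^~ x)).
suff : t m * (fun x => g^`() (t m * x) * h x)^`(n) x + (fun x => g (t m * x) * h^`() x)^`(n) x
    @[m --> \oo] --> 0 * (g^`() 0 * h^`(n) x) + g 0 * h^`()^`(n) x.
  by rewrite mul0r add0r derive1Sn.
by apply: cvgD => //; apply: cvgM.
Qed.

End scaled_product.

Definition gaussian (x : R) := expR (- x ^+ 2).

Let is_derive_poly_gaussian p x :
  is_derive x (1 : R) (fun x => p.[x] * gaussian x)
    ((deriv p - (2 *: 'X) * p).[x] * gaussian x).
Proof.
have dg : is_derive x (1 : R) gaussian (- (2 * x) * gaussian x).
  have d2 : is_derive x (1 : R) (fun y => - y ^+ 2) (- (2 * x)).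
    have := is_deriveN (is_deriveX 2 (is_derive_id x (1 : R))).
    set D := (X in is_derive _ _ _ X) => dm.
    suff <- : D = - (2 * x) by exact: dm.
    by rewrite /D /GRing.scale/=; ring.
  have := @is_derive1_comp _ expR (fun y => - y ^+ 2) x _ _ (is_derive_expR _) d2.
  by rewrite mulrC.
have := is_deriveM (is_derive_poly p x) dg.
set D := (X in is_derive _ _ _ X) => dm.
suff <- : D = (deriv p - (2 *: 'X) * p).[x] * gaussian x by exact: dm.
by rewrite /D !hornerE /GRing.scale/=; ring.
Qed.

Let derive1n_gaussian n : exists p, gaussian^`(n) = (fun x => p.[x] * gaussian x).
Proof.
elim: n => [|n [p IH]].
  by exists 1; apply/funext => x; rewrite derive1n0 hornerE mul1r.
exists (deriv p - (2 *: 'X) * p); rewrite derive1nS IH; apply/funext => x.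
exact/is_derive_derive1/is_derive_poly_gaussian.
Qed.

(** The exponential series gives [(x ^ 2) ^ i <= i! exp (x ^ 2)], and [|x ^ i| <= 1 + (x ^ 2) ^ i]
    reduces to even powers; hence the constant [1 + i!] for each monomial. *)
Let bounded_poly_gaussian p : exists M, forall x, `|p.[x] * gaussian x| <= M.
Proof.
have key i x : `|x ^+ i| * gaussian x <= 1 + i`!%:R.
  have g1 : gaussian x <= 1 by rewrite expR_le1 oppr_le0 sqr_ge0.
  have x2 : (x ^+ 2) ^+ i * gaussian x <= i`!%:R.
    rewrite /gaussian expRN ler_pdivrMr ?expR_gt0//.
    case: i => [|i]; first by rewrite expr0 fact0 mul1r -expR0 ler_expR sqr_ge0.
    have := expR_ge1Dxn i (sqr_ge0 x).
    move=> /(le_trans _) => /(_ ((x ^+ 2) ^+ i.+1 / i.+1`!%:R)).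
    rewrite lerDr => /(_ ler01); rewrite ler_pdivrMr ?ltr0n ?fact_gt0//.
    by rewrite mulrC.
  have xi : `|x ^+ i| <= 1 + (x ^+ 2) ^+ i.
    rewrite -exprM mulnC exprM -[(x ^+ i) ^+ 2]real_normK ?num_real//.
    set u := `|x ^+ i|; have u0 : 0 <= u by exact: normr_ge0.
    by have := sqr_ge0 (u - 1); nra.
  apply: (@le_trans _ _ ((1 + (x ^+ 2) ^+ i) * gaussian x)).
    by rewrite ler_wpM2r ?expR_ge0.
  by rewrite mulrDl mul1r lerD.
exists (\sum_(i < size p) `|p`_i| * (1 + i`!%:R)) => x.
rewrite horner_coef mulr_suml (le_trans (ler_norm_sum _ _ _))// ler_sum// => i _.
rewrite -mulrA normrM ler_wpM2l// normrM (ger0_norm (expR_ge0 _)).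
exact: key.
Qed.

Lemma schwartz_gaussian : schwartz gaussian.
Proof.
split=> [n x|k n].
  have [p ->] := derive1n_gaussian n.
  by have [] := is_derive_poly_gaussian p x.
have [p E] := derive1n_gaussian n.
have [M pM] := bounded_poly_gaussian ('X^k * p).
by exists M => x; move: (pM x); rewrite E hornerM hornerXn -mulrA.
Qed.

End gaussian_cutoff.

Section stein_identity_extension.
Context {R : realType} (n : nat) (wt a : 'I_n -> R).

Lemma diffop_family_bounded (f_ : nat -> R -> R) p :
  (forall l, exists M, forall m x, `|derive1n l (f_ m) x| <= M) ->
  exists M, forall m x, `|diffop p (f_ m) x| <= M.
Proof.
move=> /choice[M fM]; exists (\sum_(i < size p) `|p`_i| * M i) => m x.
rewrite (le_trans (ler_norm_sum _ _ _))// ler_sum// => i _.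
by rewrite normrM ler_wpM2l.
Qed.

(** The bound is affine in [|x|], hence integrable for a law with a first moment, and uniform in
    [m], as dominated convergence demands. *)
Lemma stein_integrand_family_bounded (f_ : nat -> R -> R) :
  (forall l, exists M, forall m x, `|derive1n l (f_ m) x| <= M) ->
  exists M, forall m x, `|stein_integrand wt a (f_ m) x| <= M * (1 + `|x|).
Proof.
move=> bf; have [M AM] := diffop_family_bounded (symbol_poly a) bf.
have /choice[M_ AM_] : forall k, exists M, forall m x,
    `|diffop (symbol_poly (drop_entry k a)) (f_ m) x| <= M.
  by move=> k; exact: diffop_family_bounded.
have M0 : 0 <= M by rewrite (le_trans _ (AM 0%N 0)).
have S0 : 0 <= \sum_(k < n) `|wt k| * (M + M_ k).
  by rewrite sumr_ge0// => k _; rewrite mulr_ge0// addr_ge0// (le_trans _ (AM_ k 0%N 0)).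
exists (M + \sum_(k < n) `|wt k| * (M + M_ k)) => m x.
rewrite (le_trans (ler_normD _ _))// mulrDr mulr1 addrC lerD//.
  rewrite (le_trans (ler_norm_sum _ _ _))// (@le_trans _ _ (\sum_(k < n) `|wt k| * (M + M_ k)))//.
    apply: ler_sum => k _; rewrite normrM ler_wpM2l// (le_trans (ler_normB _ _))//.
    by rewrite lerD.
  by rewrite lerDr.
rewrite normrM mulrC ler_wpM2r// (le_trans (AM _ _))// lerDl//.
Qed.

Lemma cvg_sum_seq (I : Type) (r : seq I) (u : I -> nat -> R) (l : I -> R) :
  (forall i, u i m @[m --> \oo] --> l i) ->
  \sum_(i <- r) u i m @[m --> \oo] --> \sum_(i <- r) l i.
Proof.
move=> ul; elim: r => [|i r IH].
  by rewrite big_nil; under eq_fun do rewrite big_nil; exact: cvg_cst.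
by rewrite big_cons; under eq_fun do rewrite big_cons; exact: cvgD.
Qed.

Lemma cvg_diffop (f_ : nat -> R -> R) (f : R -> R) p x :
  (forall l, derive1n l (f_ m) x @[m --> \oo] --> derive1n l f x) ->
  diffop p (f_ m) x @[m --> \oo] --> diffop p f x.
Proof.
by move=> cf; apply: cvg_sum_seq => i; apply: cvgM => //; exact: cvg_cst.
Qed.

Lemma cvg_stein_integrand (f_ : nat -> R -> R) (f : R -> R) x :
  (forall l, derive1n l (f_ m) x @[m --> \oo] --> derive1n l f x) ->
  stein_integrand wt a (f_ m) x @[m --> \oo] --> stein_integrand wt a f x.
Proof.
move=> cf; apply: cvgD.
  by apply: cvgM; [exact: cvg_cst|exact: cvg_diffop].
apply: cvg_sum_seq => k; apply: cvgM; first exact: cvg_cst.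
by apply: cvgB; exact: cvg_diffop.
Qed.

Lemma measurable_stein_integrand (f : R -> R) : smooth_bounded f ->
  measurable_fun setT (stein_integrand wt a f).
Proof.
move=> sf.
have mp p : measurable_fun setT (diffop p f).
  apply: continuous_measurable_fun; apply: smooth_bounded_continuous.
  exact: smooth_bounded_diffop.
apply: measurable_funD; first exact: measurable_funM.
by apply: measurable_sum => k; apply: measurable_funM => //; exact: measurable_funB.
Qed.

Lemma integrable_stein_integrand (mu : probability R R) (f : R -> R) :
  mu.-integrable setT (EFin \o (fun x : R => x)) -> smooth_bounded f ->
  mu.-integrable setT (EFin \o stein_integrand wt a f).
Proof.
move=> imu sf.
have [M fM] := @stein_integrand_family_bounded (fun=> f)
  (fun l => let: ex_intro M h := sf.2 l in ex_intro _ M (fun _ => h)).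
apply: (@le_integrable_EFin _ _ _ mu setT measurableT _ (fun x => M * (1 + `|x|))).
- exact: measurable_stein_integrand.
- by move=> x _; exact: (fM 0%N).
- have i1 := finite_measure_integrable_cst mu (1 : R) measurableT.
  have := integrableZl measurableT M (integrableD measurableT i1 (integrable_norm imu)).
  by apply: eq_integrable => // x _ /=; rewrite EFinM EFinD.
Qed.

Lemma stein_identity_smooth_bounded (mu : probability R R) :
  mu.-integrable setT (EFin \o (fun x : R => x)) ->
  (forall f, schwartz f -> \int[mu]_x stein_integrand wt a f x = 0) ->
  forall f, smooth_bounded f -> \int[mu]_x stein_integrand wt a f x = 0.
Proof.
move=> imu H f sf.
pose t (m : nat) : R := (m.+1%:R)^-1.
have t0 : t m @[m --> \oo] --> (0 : R) by exact: cvg_harmonic.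
have t1 m : `|t m| <= 1 by rewrite ger0_norm ?invr_ge0// invf_le1 ?ler1n.
have sg := schwartz_smooth_bounded (@schwartz_gaussian R).
(* Since [gaussian 0 = 1], every derivative of [f_ m] tends pointwise and boundedly to that of
   [f]. *)
pose f_ m x := gaussian (t m * x) * f x.
have sf_ m : schwartz (f_ m).
  apply: schwartz_mul => //; apply: schwartz_scale; last exact: schwartz_gaussian.
  by rewrite invr_eq0.
have bf_ l : exists M, forall m x, `|derive1n l (f_ m) x| <= M.
  by have [] := scaled_product_derive1n t0 t1 l sg sf.
have cf_ x l : derive1n l (f_ m) x @[m --> \oo] --> derive1n l f x.
  have [_ /(_ x)] := scaled_product_derive1n t0 t1 l sg sf.
  by rewrite /gaussian expr0n oppr0 expR0 mul1r.
have [M f_M] := stein_integrand_family_bounded bf_.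
have cv : \int[mu]_x stein_integrand wt a (f_ m) x @[m --> \oo] -->
    \int[mu]_x stein_integrand wt a f x.
  apply: (@dominated_cvg_Rintegral _ _ _ mu setT measurableT
    (fun m => stein_integrand wt a (f_ m)) _ (fun x => M * (1 + `|x|))).
  - by move=> m; apply: measurable_stein_integrand; exact: schwartz_smooth_bounded.
  - by move=> x _; exact: cvg_stein_integrand.
  - have i1 := finite_measure_integrable_cst mu (1 : R) measurableT.
    have := integrableZl measurableT M (integrableD measurableT i1 (integrable_norm imu)).
    by apply: eq_integrable => // x _ /=; rewrite EFinM EFinD.
  - by move=> m x _; exact: f_M.
have I0 m : \int[mu]_x stein_integrand wt a (f_ m) x = 0 by exact: H.
have cv0 : \int[mu]_x stein_integrand wt a (f_ m) x @[m --> \oo] --> 0.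
  by rewrite (eq_cvg _ _ I0); exact: cvg_cst.
exact: cvg_unique cv cv0.
Qed.

End stein_identity_extension.

(** * The differential equation of the characteristic function *)

Section trigonometric.
Context {R : realType}.
Implicit Types xi u v x y : R.

(** The real part of [(u - i v) exp (i xi x)]. Arbitrary [u] and [v] make the family of frequency
    [xi] stable under differentiation. *)
Definition trig xi u v (x : R) : R := u * cos (xi * x) + v * sin (xi * x).

(** Both derivatives come from the one computation [D], because [xi] and [x] enter through their
    product. *)
Let is_derive_trig2 xi u v x :
  is_derive xi (1 : R) (fun xi => trig xi u v x) (x * trig xi v (- u) x) /\
  is_derive x (1 : R) (trig xi u v) (trig xi (xi * v) (- (xi * u)) x).
Proof.
have dl (s t : R) : is_derive t (1 : R) (fun z => s * z) s.
  by have := is_deriveZ s (is_derive_id t (1 : R)); rewrite [_ *: _]mulr1.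
have dc (s t : R) : is_derive t (1 : R) (fun z => cos (s * z)) (s * - sin (s * t)).
  have := @is_derive1_comp _ cos (fun z => s * z) t _ _ (is_derive_cos _) (dl s t).
  by rewrite mulrC.
have ds (s t : R) : is_derive t (1 : R) (fun z => sin (s * z)) (s * cos (s * t)).
  have := @is_derive1_comp _ sin (fun z => s * z) t _ _ (is_derive_sin _) (dl s t).
  by rewrite mulrC.
have D (s t : R) : is_derive t (1 : R) (fun z => u * cos (s * z) + v * sin (s * z))
    (u * (s * - sin (s * t)) + v * (s * cos (s * t))).
  exact: is_deriveD (is_deriveZ u (dc s t)) (is_deriveZ v (ds s t)).
split.
  have -> : (fun xi => trig xi u v x) = (fun z => u * cos (x * z) + v * sin (x * z)).
    by apply/funext => z; rewrite /trig [z * x]mulrC.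
  have -> : x * trig xi v (- u) x = u * (x * - sin (x * xi)) + v * (x * cos (x * xi)).
    by rewrite /trig [xi * x]mulrC; ring.
  exact: D.
have -> : trig xi (xi * v) (- (xi * u)) x = u * (xi * - sin (xi * x)) + v * (xi * cos (xi * x)).
  by rewrite /trig; ring.
exact: D.
Qed.

Lemma is_derive_trig_freq xi u v x :
  is_derive xi (1 : R) (fun xi => trig xi u v x) (x * trig xi v (- u) x).
Proof. by have [] := is_derive_trig2 xi u v x. Qed.

Lemma is_derive_trig xi u v x :
  is_derive x (1 : R) (trig xi u v) (trig xi (xi * v) (- (xi * u)) x).
Proof. by have [] := is_derive_trig2 xi u v x. Qed.

Lemma derive1_trig xi u v : derive1 (trig xi u v) = trig xi (xi * v) (- (xi * u)).
Proof. by apply/funext => x; exact/is_derive_derive1/is_derive_trig. Qed.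

Lemma derive1n_trig xi u v l : exists u' v', derive1n l (trig xi u v) = trig xi u' v'.
Proof.
elim: l => [|l [u' [v' IH]]]; first by exists u, v.
by exists (xi * v'), (- (xi * u')); rewrite derive1nS IH derive1_trig.
Qed.

Lemma trig_bounded xi u v x : `|trig xi u v x| <= `|u| + `|v|.
Proof.
rewrite (le_trans (ler_normD _ _))// lerD// normrM ler_piMr//.
  exact: cos_max.
exact: sin_max.
Qed.

Lemma smooth_bounded_trig xi u v : smooth_bounded (trig xi u v).
Proof.
split=> [l x|l]; have [u' [v' ->]] := derive1n_trig xi u v l.
  by have [] := is_derive_trig xi u' v' x.
by exists (`|u'| + `|v'|) => x; exact: trig_bounded.
Qed.

Lemma diffop_trig (p : {poly R}) xi u v : exists u' v', diffop p (trig xi u v) = trig xi u' v'.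
Proof.
rewrite /diffop; elim: (size p) => [|N [u' [v' IH]]].
  by exists 0, 0; apply/funext => x; rewrite big_ord0 /trig !mul0r addr0.
have [u2 [v2 E]] := derive1n_trig xi u v N.
exists (u' + p`_N * u2), (v' + p`_N * v2); apply/funext => x.
rewrite big_ord_recr/=; have -> := congr1 (fun F => F x) IH.
by rewrite E /trig; ring.
Qed.

(* On the span of [cos (xi x)] and [sin (xi x)] the second derivative is [- xi ^ 2],
   so [1 - a D] is inverted by [(1 + a D) / (1 + (a xi) ^ 2)]. *)
Lemma trig_resolvent xi a u v (g : R -> R) :
  (forall x, trig xi u v x - a * derive1 (trig xi u v) x = g x) ->
  (forall x, derivable g x 1) ->
  forall x, (1 + (a * xi) ^+ 2) * trig xi u v x = g x + a * derive1 g x.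
Proof.
move=> gE dg x.
have -> : g = (fun x => 1 * trig xi u v x + (- a) * trig xi (xi * v) (- (xi * u)) x).
  by apply/funext => y; rewrite -gE derive1_trig mul1r mulNr.
rewrite derive1_lin; last 2 first.
  by move=> y; have [] := is_derive_trig xi u v y.
  by move=> y; have [] := is_derive_trig xi (xi * v) (- (xi * u)) y.
by rewrite !derive1_trig /trig; ring.
Qed.

Lemma diffop_trig_surjective n (a : 'I_n -> R) xi u v :
  exists u' v', diffop (symbol_poly a) (trig xi u' v') = trig xi u v.
Proof.
elim: n a u v => [|n IH] a u v.
  by exists u, v; rewrite /symbol_poly big_ord0 diffop1.
pose b := a ord0; have D0 : 1 + (b * xi) ^+ 2 != 0.
  by rewrite gt_eqF// ltr_wpDr// sqr_ge0.
(* [u1] and [v1] are the coefficients of [(1 + b D) / (1 + (b xi) ^ 2)] applied to [trig xi u v]. *)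
pose u1 := (u + b * xi * v) / (1 + (b * xi) ^+ 2).
pose v1 := (v - b * xi * u) / (1 + (b * xi) ^+ 2).
have [u' [v' E]] := IH (drop_entry ord0 a) u1 v1.
exists u', v'; apply/funext => x; rewrite (symbol_poly_drop a ord0) diffopM_linear; last first.
  by case: (smooth_bounded_trig xi u' v').
rewrite E derive1_trig /trig -/b /u1 /v1; field.
exact: D0.
Qed.

End trigonometric.

Section characteristic_function_ode.
Context {R : realType}.
Implicit Types (mu nu : probability R R) (xi u v x y : R).

Let measurable_trig xi u v : measurable_fun setT (trig xi u v).
Proof.
apply: continuous_measurable_fun; apply: smooth_bounded_continuous.
exact: smooth_bounded_trig.
Qed.

Lemma integrable_trig mu xi u v : mu.-integrable setT (EFin \o trig xi u v).
Proof. by apply: bounded_integrable; [exact: measurable_trig|exact: trig_bounded]. Qed.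

Lemma integrable_id_trig mu xi u v : mu.-integrable setT (EFin \o (fun x : R => x)) ->
  mu.-integrable setT (EFin \o (fun x => x * trig xi u v x)).
Proof.
move=> imu; apply: (@integrable_mulr_bounded _ _ _ mu (fun x : R => x) _ (`|u| + `|v|)) => //.
by move=> x; exact: trig_bounded.
Qed.

Lemma is_derive_integral_trig mu xi u v :
  mu.-integrable setT (EFin \o (fun x : R => x)) ->
  is_derive xi (1 : R) (fun xi => \int[mu]_x trig xi u v x)
    (\int[mu]_x (x * trig xi v (- u) x)).
Proof.
move=> imu.
pose f (s : R) (y : R) := trig s u v y.
have Ixi : `](xi - 1), (xi + 1)[%classic xi.
  by rewrite /= in_itv/= ltrBlDr ltrDl ltr01.
have i1 s : `](xi - 1), (xi + 1)[%classic s -> mu.-integrable setT (EFin \o f s).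
  by move=> _; exact: integrable_trig.
have d1 s y : `](xi - 1), (xi + 1)[%classic s -> setT y -> derivable (f ^~ y) s 1.
  by move=> _ _; have [] := is_derive_trig_freq s u v y.
(* Differentiating in the frequency brings out a factor [y], so the domination rests on the first
   moment. *)
pose G (y : R) := (`|u| + `|v|) * `|y|.
have G0 y : 0 <= G y by rewrite mulr_ge0// addr_ge0.
have iG : mu.-integrable setT (EFin \o G).
  have := integrableZl measurableT (`|u| + `|v|) (integrable_norm imu).
  by apply: eq_integrable => // y _ /=; rewrite EFinM.
have pE s y : partial1of2 f s y = y * trig s v (- u) y.
  by rewrite /partial1of2; apply: is_derive_derive1; exact: is_derive_trig_freq.
have bG s y : `](xi - 1), (xi + 1)[%classic s -> setT y -> `|partial1of2 f s y| <= G y.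
  move=> _ _; rewrite pE normrM mulrC ler_wpM2r// (le_trans (trig_bounded _ _ _ _))//.
  by rewrite normrN addrC.
split; first exact: (derivable_under_integral measurableT Ixi i1 d1 G0 iG bG).
rewrite -derive1E (differentiation_under_integral measurableT Ixi i1 d1 G0 iG bG).
by apply: eq_Rintegral => y _; exact: pE.
Qed.

Section identity.
Context (n : nat) (k a : 'I_n -> R).
Let wt i := k i * a i.

(** The differential equation in real form. By [is_derive_integral_trig] the left side at [(v, - u)]
    is the derivative in [xi] of the integral of [trig xi u v]; the summand on the right is
    [wt i * a i] times the integral of [D (1 - a_i D)^-1] applied to [trig xi u v]. *)
Definition trig_identity mu := forall xi u v,
  \int[mu]_y (y * trig xi u v y) =
  \sum_(i < n) wt i * (a i / (1 + (a i * xi) ^+ 2)) *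
    (\int[mu]_y trig xi (xi * v) (- (xi * u)) y - a i * xi ^+ 2 * \int[mu]_y trig xi u v y).

Lemma stein_identity_trig mu : mu.-integrable setT (EFin \o (fun x : R => x)) ->
  (forall f, smooth_bounded f -> \int[mu]_x stein_integrand wt a f x = 0) ->
  trig_identity mu.
Proof.
move=> imu H xi u v.
have [u' [v' E]] := diffop_trig_surjective a xi u v.
set h := trig xi u' v' in E.
have sh : smooth_bounded h by exact: smooth_bounded_trig.
have pt y : stein_integrand wt a h y = y * trig xi u v y -
    \sum_(i < n) wt i * (a i / (1 + (a i * xi) ^+ 2)) *
      (trig xi (xi * v) (- (xi * u)) y - a i * xi ^+ 2 * trig xi u v y).
  rewrite /stein_integrand E; congr (_ + _); rewrite -sumrN; apply: eq_bigr => i _.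
  (* [A_i h] lies in the span of the cosine and sine with coefficients unknown so far; it solves
     [psi - a_i psi' = trig xi u v], and the resolvent identifies it. *)
  have [ui [vi Ei]] := diffop_trig (symbol_poly (drop_entry i a)) xi u' v'.
  have := E; rewrite (symbol_poly_drop a i) => Ei'.
  have R1 x : trig xi ui vi x - a i * derive1 (trig xi ui vi) x = trig xi u v x.
    by rewrite -Ei' diffopM_linear ?Ei//; case: sh.
  have := trig_resolvent R1 (fun x => @ex_derive _ _ _ _ _ _ _ (is_derive_trig xi u v x)) y.
  have D0 : 1 + (a i * xi) ^+ 2 != 0 by rewrite gt_eqF// ltr_wpDr// sqr_ge0.
  rewrite derive1_trig Ei => R2.
  have -> : trig xi ui vi y =
      (trig xi u v y + a i * trig xi (xi * v) (- (xi * u)) y) / (1 + (a i * xi) ^+ 2).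
    by rewrite -R2; field; exact: D0.
  by field; exact: D0.
have := H h sh; rewrite (eq_Rintegral _ (fun y _ => pt y)).
have i2 i : mu.-integrable setT (EFin \o (fun y => wt i * (a i / (1 + (a i * xi) ^+ 2)) *
      (trig xi (xi * v) (- (xi * u)) y - a i * xi ^+ 2 * trig xi u v y))).
  have := integrableZl measurableT (wt i * (a i / (1 + (a i * xi) ^+ 2)))
    (integrableB measurableT (integrable_trig mu xi (xi * v) (- (xi * u)))
      (integrableZl measurableT (a i * xi ^+ 2) (integrable_trig mu xi u v))).
  by apply: eq_integrable => // y _ /=; rewrite EFinM EFinB EFinM.
have i3 : mu.-integrable setT (EFin \o (fun y => \sum_(i < n) wt i * (a i / (1 + (a i * xi) ^+ 2)) *
      (trig xi (xi * v) (- (xi * u)) y - a i * xi ^+ 2 * trig xi u v y))).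
  have := integrable_sum measurableT (index_enum 'I_n) (P := predT) (fun i _ => i2 i).
  by apply: eq_integrable => // y _ /=; rewrite sumEFin.
rewrite RintegralB//; last exact: integrable_id_trig.
move=> /eqP; rewrite subr_eq0 => /eqP ->.
rewrite {1}/Rintegral; under eq_integral do rewrite -sumEFin.
rewrite integral_sum//.
transitivity (\sum_(i < n) \int[mu]_y (wt i * (a i / (1 + (a i * xi) ^+ 2)) *
      (trig xi (xi * v) (- (xi * u)) y - a i * xi ^+ 2 * trig xi u v y))).
  rewrite /Rintegral -[RHS]/(fine (\sum_(i < n) _)%:E) -sumEFin; congr fine.
  by apply: eq_bigr => i _; rewrite fineK// (integrable_fin_num measurableT (i2 i)).
apply: eq_bigr => i _; rewrite RintegralZl//.
  rewrite RintegralB//; last 2 first.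
  - exact: integrable_trig.
  - have := integrableZl measurableT (a i * xi ^+ 2) (integrable_trig mu xi u v).
    by apply: eq_integrable => // y _ /=; rewrite EFinM.
  by rewrite RintegralZl//; exact: integrable_trig.
have := integrableB measurableT (integrable_trig mu xi (xi * v) (- (xi * u)))
      (integrableZl measurableT (a i * xi ^+ 2) (integrable_trig mu xi u v)).
by apply: eq_integrable => // y _ /=; rewrite EFinB EFinM.
Qed.

Let integral_trig_lin mu xi u v : \int[mu]_y trig xi u v y =
  u * \int[mu]_y trig xi 1 0 y + v * \int[mu]_y trig xi 0 1 y.
Proof.
have E y : trig xi u v y = u * trig xi 1 0 y + v * trig xi 0 1 y by rewrite /trig; ring.
rewrite (eq_Rintegral _ (fun y _ => E y)) RintegralD//.
- by rewrite !RintegralZl//; exact: integrable_trig.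
- have := integrableZl measurableT u (integrable_trig mu xi 1 0).
  by apply: eq_integrable => // y _ /=; rewrite EFinM.
- have := integrableZl measurableT v (integrable_trig mu xi 0 1).
  by apply: eq_integrable => // y _ /=; rewrite EFinM.
Qed.

Hypothesis k0 : forall i, 0 < k i.

(* The squared modulus of the difference of the two characteristic functions vanishes
   at [0] and is nonincreasing on the positive half-line. *)
Let trig_unique_pos mu nu :
  mu.-integrable setT (EFin \o (fun x : R => x)) ->
  nu.-integrable setT (EFin \o (fun x : R => x)) ->
  trig_identity mu -> trig_identity nu -> forall xi, 0 <= xi -> forall u v,
  \int[mu]_x trig xi u v x = \int[nu]_x trig xi u v x.
Proof.
move=> imu inu Hmu Hnu xi xi0 u v.
pose C s := \int[mu]_x trig s 1 0 x - \int[nu]_x trig s 1 0 x.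
pose S s := \int[mu]_x trig s 0 1 x - \int[nu]_x trig s 0 1 x.
pose N s := C s ^+ 2 + S s ^+ 2.
pose w s i := wt i * (a i / (1 + (a i * s) ^+ 2)).
(* [wt i] contains a factor [a i], so a square appears and the sign of [a i] does not matter. *)
have w0 s i : 0 <= w s i.
  have -> : w s i = k i * (a i ^+ 2 / (1 + (a i * s) ^+ 2)) by rewrite /w /wt; ring.
  by rewrite mulr_ge0 ?(ltW (k0 i))// divr_ge0 ?addr_ge0 ?sqr_ge0.
have DC s : is_derive s (1 : R) C (\sum_(i < n) w s i * (- s * C s + a i * s ^+ 2 * S s)).
  have := is_deriveB (is_derive_integral_trig s 1 0 imu) (is_derive_integral_trig s 1 0 inu).
  set D := (X in is_derive _ _ _ X) => dm.
  suff <- : D = \sum_(i < n) w s i * (- s * C s + a i * s ^+ 2 * S s) by exact: dm.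
  rewrite /D Hmu Hnu -sumrB; apply: eq_bigr => i _.
  rewrite (integral_trig_lin mu s (s * - 1)) (integral_trig_lin nu s (s * - 1)).
  rewrite (integral_trig_lin mu s 0 (- 1)) (integral_trig_lin nu s 0 (- 1)).
  by rewrite /w /C /S; ring.
have DS s : is_derive s (1 : R) S (\sum_(i < n) w s i * (- s * S s - a i * s ^+ 2 * C s)).
  have := is_deriveB (is_derive_integral_trig s 0 1 imu) (is_derive_integral_trig s 0 1 inu).
  set D := (X in is_derive _ _ _ X) => dm.
  suff <- : D = \sum_(i < n) w s i * (- s * S s - a i * s ^+ 2 * C s) by exact: dm.
  rewrite /D Hmu Hnu -sumrB; apply: eq_bigr => i _.
  rewrite (integral_trig_lin mu s (s * - 0)) (integral_trig_lin nu s (s * - 0)).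
  rewrite (integral_trig_lin mu s 1 (- 0)) (integral_trig_lin nu s 1 (- 0)).
  by rewrite /w /C /S; ring.
(* The terms in [s ^+ 2] only rotate the vector [(C s, S s)]: their contributions to the derivative
   of [N] cancel. *)
have DN s : is_derive s (1 : R) N (- (2 * s * (\sum_(i < n) w s i) * N s)).
  have := is_deriveD (is_deriveX 2 (DC s)) (is_deriveX 2 (DS s)).
  set D := (X in is_derive _ _ _ X) => dm.
  suff <- : D = - (2 * s * (\sum_(i < n) w s i) * N s) by exact: dm.
  have -> : - (2 * s * (\sum_(i < n) w s i) * N s) = \sum_(i < n) - (2 * s * N s) * w s i.
    by rewrite -mulr_sumr; ring.
  rewrite /D /GRing.scale/= !expr1 !mulr_sumr -big_split/=; apply: eq_bigr => i _.
  by rewrite /N; ring.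
have cN : continuous N.
  by move=> s; apply: differentiable_continuous; apply/derivable1_diffP; case: (DN s).
have N0 : N 0 = 0.
  rewrite /N /C /S.
  have c0 (y : R) : trig 0 1 0 y = 1 by rewrite /trig !mul0r cos0 mul1r addr0.
  have s0 (y : R) : trig 0 0 1 y = 0 by rewrite /trig !mul0r sin0 mulr0 addr0.
  rewrite !(eq_Rintegral _ (fun y _ => c0 y)) !(eq_Rintegral _ (fun y _ => s0 y)).
  rewrite !Rintegral_cst// !mul0r subrr expr0n/= addr0.
  by rewrite ![X in fine X](_ : _ = 1%E) ?probability_setT// subrr expr0n.
have Nle : N xi <= N 0.
  have h1 s : s \in `]0, +oo[ -> derivable N s 1 by move=> _; case: (DN s).
  have h2 s : s \in `]0, +oo[ -> derive1 N s <= 0.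
    rewrite in_itv/= andbT => s0.
    rewrite (is_derive_derive1 (DN s)) oppr_le0 !mulr_ge0 ?sumr_ge0 ?(ltW s0)//.
    by rewrite /N addr_ge0 ?sqr_ge0.
  have h3 : {within `[0, +oo[, continuous N} by exact: continuous_subspaceT.
  exact: (ler0_derive1_nincry h1 h2 h3 (lexx 0) xi0).
have : N xi == 0.
  by rewrite eq_le -{1}N0 Nle /N addr_ge0 ?sqr_ge0.
rewrite /N paddr_eq0 ?sqr_ge0// !sqrf_eq0 => /andP[/eqP Cx /eqP Sx].
rewrite integral_trig_lin [RHS]integral_trig_lin.
by move/eqP: Cx; move/eqP: Sx; rewrite !subr_eq0 => /eqP -> /eqP ->.
Qed.

Lemma trig_unique mu nu :
  mu.-integrable setT (EFin \o (fun x : R => x)) ->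
  nu.-integrable setT (EFin \o (fun x : R => x)) ->
  trig_identity mu -> trig_identity nu -> forall xi u v,
  \int[mu]_x trig xi u v x = \int[nu]_x trig xi u v x.
Proof.
move=> imu inu Hmu Hnu xi u v; have [xi0|xi0] := leP 0 xi.
  exact: trig_unique_pos.
have E y : trig xi u v y = trig (- xi) u (- v) y.
  by rewrite /trig mulNr cosN sinN mulrNN.
rewrite (eq_Rintegral _ (fun y _ => E y)) [RHS](eq_Rintegral _ (fun y _ => E y)).
by apply: trig_unique_pos => //; rewrite oppr_ge0 ltW.
Qed.

End identity.
End characteristic_function_ode.

(** * Trigonometric integrals determine the law *)

Section sign_approximation.
Context {R : realType}.
Implicit Types t x y : R.

(* [1] and [- 1] are superattracting fixed points. *)
Definition sign_step t : R := (3 * t - t ^+ 3) / 2.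

Lemma sign_step_norm_le1 t : `|t| <= 1 -> `|sign_step t| <= 1.
Proof.
rewrite !ler_norml /sign_step => /andP[t1 t2].
(* This product is [2 (1 - sign_step t)], and the next one is [2 (1 + sign_step t)]. *)
have a1 : 0 <= (1 - t) ^+ 2 * (2 + t) by rewrite mulr_ge0 ?sqr_ge0//; lra.
have a2 : 0 <= (1 + t) ^+ 2 * (2 - t) by rewrite mulr_ge0 ?sqr_ge0//; lra.
by apply/andP; split; nra.
Qed.

Lemma iter_sign_step_norm_le1 n t : `|t| <= 1 -> `|iter n sign_step t| <= 1.
Proof. by move=> t1; elim: n => [//|n IH]; rewrite iterS sign_step_norm_le1. Qed.

Lemma sign_stepN t : sign_step (- t) = - sign_step t.
Proof. by rewrite /sign_step; field. Qed.

Lemma iter_sign_stepN n t : iter n sign_step (- t) = - iter n sign_step t.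
Proof. by elim: n => [//|n IH]; rewrite !iterS IH sign_stepN. Qed.

Let cvg_iter_sign_step_pos t : 0 < t -> t <= 1 -> iter n sign_step t @[n --> \oo] --> (1 : R).
Proof.
(* One step multiplies [1 - y] by [(1 - y) (2 + y) / 2], which decreases in [y > 0]. The iterates
   stay above [t], as the last conjunct of [key] records, so [rho] bounds all these factors. *)
move=> t0 t1; pose rho := (1 - t) * (2 + t) / 2.
have rho0 : 0 <= rho by rewrite divr_ge0// mulr_ge0//; lra.
have rho1 : rho < 1.
  rewrite /rho ltr_pdivrMr// mul1r.
  have : 0 < t * (1 + t) by rewrite mulr_gt0//; lra.
  nra.
have key n : 0 <= 1 - iter n sign_step t /\ 1 - iter n sign_step t <= rho ^+ n * (1 - t)
    /\ 1 - iter n sign_step t <= 1 - t.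
  elim: n => [|n [IH0 [IH1 IH2]]]; first by rewrite /= expr0 mul1r; lra.
  rewrite iterS; set y := iter n sign_step t in IH0 IH1 IH2 *.
  have E : 1 - sign_step y = (1 - y) * ((1 - y) * (2 + y) / 2) by rewrite /sign_step; field.
  have b : (1 - y) * (2 + y) / 2 <= rho.
    rewrite /rho ler_pM2r ?invr_gt0//.
    have : 0 <= (y - t) * (1 + t + y) by apply: mulr_ge0; lra.
    nra.
  have b0 : 0 <= (1 - y) * (2 + y) / 2 by rewrite divr_ge0// mulr_ge0//; lra.
  rewrite E; split; first by rewrite mulr_ge0.
  have c : (1 - y) * ((1 - y) * (2 + y) / 2) <= (1 - y) * rho by rewrite ler_wpM2l.
  split; last first.
    apply: le_trans c _; apply: le_trans _ IH2.
    by rewrite -[leRHS]mulr1 ler_wpM2l// ltW.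
  apply: le_trans c _.
  have -> : rho ^+ n.+1 * (1 - t) = rho ^+ n * (1 - t) * rho by rewrite exprS; ring.
  by rewrite ler_wpM2r.
have e0 : 1 - iter n sign_step t @[n --> \oo] --> (0 : R).
  apply: (@squeeze_cvgr _ _ _ _ (fun=> 0) (fun n => rho ^+ n * (1 - t))).
  - by apply: nearW => n; have [-> [-> _]] := key n.
  - exact: cvg_cst.
  - rewrite -[X in _ --> X](mul0r (1 - t)); apply: cvgM; last exact: cvg_cst.
    by apply: cvg_expr; rewrite ger0_norm.
have : 1 - (1 - iter n sign_step t) @[n --> \oo] --> (1 - 0 : R).
  by apply: cvgB; [exact: cvg_cst|exact: e0].
by rewrite subr0; under eq_fun do rewrite subKr.
Qed.

Lemma cvg_iter_sign_step t : `|t| <= 1 -> iter n sign_step t @[n --> \oo] --> Num.sg t.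
Proof.
rewrite ler_norml => /andP[tN1 t1].
have [t0|t0|<-] := ltgtP 0 t.
- by rewrite gtr0_sg//; exact: cvg_iter_sign_step_pos.
- rewrite ltr0_sg//.
  have c1 : iter n sign_step (- t) @[n --> \oo] --> (1 : R).
    by apply: cvg_iter_sign_step_pos; lra.
  have N1 : - iter n sign_step (- t) @[n --> \oo] --> (- 1 : R) by exact: cvgN.
  have E n : - iter n sign_step (- t) = iter n sign_step t by rewrite iter_sign_stepN opprK.
  by move: N1; rewrite (eq_cvg _ _ E).
- rewrite sgr0; have z n : iter n sign_step (0 : R) = 0.
    by elim: n => [//|n IH]; rewrite iterS IH /sign_step expr0n/= mulr0 subr0 mul0r.
  by under eq_fun do rewrite z; exact: cvg_cst.
Qed.

End sign_approximation.

Section trigonometric_polynomials.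
Context {R : realType}.

Inductive trig_poly : (R -> R) -> Prop :=
| TrigPoly0 : trig_poly (fun=> 0)
| TrigPolyD xi u v g : trig_poly g -> trig_poly (fun x => trig xi u v x + g x).

Lemma trig_poly_trig xi u v : trig_poly (trig xi u v).
Proof.
have -> : trig xi u v = (fun x => trig xi u v x + 0) by apply/funext => x; rewrite addr0.
exact/TrigPolyD/TrigPoly0.
Qed.

Lemma trig_polyD f g : trig_poly f -> trig_poly g -> trig_poly (fun x => f x + g x).
Proof.
move=> tf tg; elim: tf => [|xi u v h th IH].
  by have -> : (fun x => 0 + g x) = g by apply/funext => x; rewrite add0r.
have -> : (fun x => trig xi u v x + h x + g x) = (fun x => trig xi u v x + (h x + g x)).
  by apply/funext => x; rewrite addrA.
exact: TrigPolyD.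
Qed.

Lemma trig_polyM f g : trig_poly f -> trig_poly g -> trig_poly (fun x => f x * g x).
Proof.
move=> tf tg; elim: tf => [|xi u v h th IH].
  have -> : (fun x => 0 * g x) = (fun=> 0) by apply/funext => x; rewrite mul0r.
  exact: TrigPoly0.
have -> : (fun x => (trig xi u v x + h x) * g x) = (fun x => trig xi u v x * g x + h x * g x).
  by apply/funext => x; rewrite mulrDl.
apply: trig_polyD => // {th IH h}; elim: tg => [|eta w z k tk IH].
  have -> : (fun x => trig xi u v x * 0) = (fun=> 0) by apply/funext => x; rewrite mulr0.
  exact: TrigPoly0.
(* Product-to-sum formulas: the frequencies of a product are the sum and the difference. *)
have -> : (fun x => trig xi u v x * (trig eta w z x + k x)) =
    (fun x => trig (xi + eta) ((u * w - v * z) / 2) ((u * z + v * w) / 2) x +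
     (trig (xi - eta) ((u * w + v * z) / 2) ((v * w - u * z) / 2) x + trig xi u v x * k x)).
  apply/funext => x; rewrite /trig [(xi + eta) * x]mulrDl [(xi - eta) * x]mulrBl cosD cosB.
  by rewrite sinD sinB; field.
by apply: TrigPolyD; apply: TrigPolyD.
Qed.

Lemma trig_polyZ c f : trig_poly f -> trig_poly (fun x => c * f x).
Proof.
move=> tf; have -> : (fun x => c * f x) = (fun x => trig 0 c 0 x * f x).
  by apply/funext => x; rewrite /trig !mul0r cos0 mulr1 addr0.
by apply: trig_polyM => //; exact: trig_poly_trig.
Qed.

Lemma trig_poly_sign_step n f : trig_poly f -> trig_poly (fun x => iter n sign_step (f x)).
Proof.
move=> tf; elim: n => [//|n IH].
have -> : (fun x => iter n.+1 sign_step (f x)) = (fun x => (3 / 2) * iter n sign_step (f x) +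
    (- 2^-1) * (iter n sign_step (f x) * (iter n sign_step (f x) * iter n sign_step (f x)))).
  by apply/funext => x; rewrite iterS {1}/sign_step; field.
by apply: trig_polyD; apply: trig_polyZ => //; do 2 apply: trig_polyM => //.
Qed.

End trigonometric_polynomials.

Section law_determination.
Context {R : realType} (mu nu : probability R R).
Hypothesis munu : forall xi u v, \int[mu]_x trig xi u v x = \int[nu]_x trig xi u v x.

(** Measurability is included so that the class passes to bounded pointwise limits. *)
Let same_integral (g : R -> R) :=
  measurable_fun setT g /\ \int[mu]_x g x = \int[nu]_x g x.

Let same_integral_trig_poly f : trig_poly f ->
  [/\ same_integral f, mu.-integrable setT (EFin \o f) & nu.-integrable setT (EFin \o f)].
Proof.
elim=> [|xi u v g tg [[mg Eg] img ing]].
  split; [split|..] => //; last 2 first.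
  - exact: (finite_measure_integrable_cst mu 0 measurableT).
  - exact: (finite_measure_integrable_cst nu 0 measurableT).
  by rewrite !Rintegral_cst// !mul0r.
have imt := integrable_trig mu xi u v; have int := integrable_trig nu xi u v.
have mt : measurable_fun setT (trig xi u v) by have /integrableP[/measurable_EFinP] := imt.
split.
- split; first exact: measurable_funD.
  have E (m : probability R R) : m.-integrable setT (EFin \o trig xi u v) ->
      m.-integrable setT (EFin \o g) -> \int[m]_x (trig xi u v x + g x) =
      \int[m]_x trig xi u v x + \int[m]_x g x by move=> *; exact: RintegralD.
  by rewrite (E mu)// (E nu)// munu Eg.
- by have := integrableD measurableT imt img; apply: eq_integrable => // x _ /=; rewrite EFinD.
- by have := integrableD measurableT int ing; apply: eq_integrable => // x _ /=; rewrite EFinD.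
Qed.

Let same_integral_lim (g_ : nat -> R -> R) (g : R -> R) :
  (forall n, same_integral (g_ n)) -> (forall n x, `|g_ n x| <= 1) ->
  (forall x, g_ n x @[n --> \oo] --> g x) -> same_integral g.
Proof.
move=> sg bg cg; have mg_ n : measurable_fun setT (g_ n) by have [] := sg n.
split; first exact: (measurable_fun_cvg mg_ (fun x _ => cg x)).
have c (m : probability R R) : \int[m]_x g_ n x @[n --> \oo] --> \int[m]_x g x.
  apply: (@dominated_cvg_Rintegral _ _ _ m setT measurableT g_ g (cst 1)) => //.
  exact: (finite_measure_integrable_cst m 1 measurableT).
have cm := c mu; rewrite (eq_cvg _ _ (fun n => (sg n).2)) in cm.
exact: cvg_unique cm (c nu).
Qed.

(** Turns a sign into the indicator of a half-line, up to the value [1 / 2] at the jump. *)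
Let half (t : R) : R := (1 + t) / 2.

Let half_le1 (t : R) : `|t| <= 1 -> `|half t| <= 1.
Proof. by rewrite /half !ler_norml => /andP[? ?]; apply/andP; split; lra. Qed.

Let sg_le1 (t : R) : `|Num.sg t| <= 1.
Proof. by rewrite normr_sg; case: eqP => _; rewrite ?ler01. Qed.

Let cvg_half (u : nat -> R) (l : R) : u n @[n --> \oo] --> l -> half (u n) @[n --> \oo] --> half l.
Proof.
move=> ul; rewrite /half; apply: cvgM; last exact: cvg_cst.
by apply: cvgD => //; exact: cvg_cst.
Qed.

Let same_integral_sg_sin (c l : R) : same_integral (fun x => half (Num.sg (sin (l * (x - c))))).
Proof.
apply: (@same_integral_lim (fun n x => half (iter n sign_step (sin (l * (x - c)))))).
- move=> n; suff /same_integral_trig_poly[] :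
    trig_poly (fun x => half (iter n sign_step (sin (l * (x - c))))) by [].
  have -> : (fun x => half (iter n sign_step (sin (l * (x - c))))) =
      (fun x => trig 0 (2^-1) 0 x +
        2^-1 * iter n sign_step (trig l (- sin (l * c)) (cos (l * c)) x)).
    apply/funext => x; rewrite mulrBr sinB /half.
    have -> : trig 0 (2^-1) 0 x = 2^-1 by rewrite /trig !mul0r cos0 mulr1 addr0.
    have -> : trig l (- sin (l * c)) (cos (l * c)) x =
        sin (l * x) * cos (l * c) - cos (l * x) * sin (l * c) by rewrite /trig; ring.
    by field.
  apply: trig_polyD; first exact: trig_poly_trig.
  by apply: trig_polyZ; apply: trig_poly_sign_step; exact: trig_poly_trig.
- by move=> n x; apply/half_le1/iter_sign_step_norm_le1/sin_max.
- by move=> x; apply/cvg_half/cvg_iter_sign_step/sin_max.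
Qed.

(** Square waves of growing period: for fixed [x] the argument of the sine eventually lies in the
    interval from [- 1] to [1], where the sine has the sign of its argument. *)
Let same_integral_sg (c : R) : same_integral (fun x => half (Num.sg (x - c))).
Proof.
apply: (@same_integral_lim (fun n x => half (Num.sg (sin ((n.+1%:R)^-1 * (x - c)))))).
- by move=> n; exact: same_integral_sg_sin.
- by move=> n x; exact/half_le1/sg_le1.
move=> x; apply: cvg_half; apply: cvg_near_cst.
have c0 : (n.+1%:R)^-1 * (x - c) @[n --> \oo] --> (0 : R).
  by rewrite -[0](mul0r (x - c)); apply: cvgM; [exact: cvg_harmonic|exact: cvg_cst].
have /cvgr0_norm_lt/(_ _ (ltr01 : 0 < (1 : R))) := c0.
apply: filterS => n; set y := _ * (x - c) => y1.
have -> : Num.sg (x - c) = Num.sg y.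
  by rewrite sgrM [X in X * _]gtr0_sg ?mul1r.
have pos z : 0 < z -> z < 1 -> 0 < sin z.
  by move=> z0 z1; apply: sin2_gt0; rewrite z0 (lt_trans z1)// ltr1n.
move: y1; rewrite ltr_norml => /andP[yN y1].
have [y0|y0|y0] := ltgtP 0 y.
- by rewrite !gtr0_sg// pos.
- rewrite !ltr0_sg//; rewrite -oppr_gt0 -sinN; apply: pos; lra.
- by rewrite -y0 sin0.
Qed.

(** Approaching [c] from the right removes the value [1 / 2]: at [x = c] all the shifted signs are
    [- 1]. *)
Let same_integral_ray (c : R) : same_integral (\1_`]c, +oo[%classic).
Proof.
apply: (@same_integral_lim (fun n x => half (Num.sg (x - (c + (n.+1%:R)^-1))))).
- by move=> n; exact: same_integral_sg.
- by move=> n x; exact/half_le1/sg_le1.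
move=> x; apply: cvg_near_cst; rewrite indicE.
have [cx|xc] := ltP c x.
  rewrite mem_set/= ?in_itv/= ?cx//.
  have /cvgr0_norm_lt/(_ (x - c)) := @cvg_harmonic R.
  rewrite subr_gt0 => /(_ cx); apply: filterS => n /=.
  rewrite ger0_norm ?invr_ge0// => nx.
  by rewrite gtr0_sg ?/half; [field|rewrite subr_gt0 -ltrBrDl].
rewrite memNset/= ?in_itv/= ?andbT; last by rewrite ltNge xc.
apply: nearW => n; rewrite ltr0_sg ?/half; first by field.
by rewrite subr_lt0 (le_lt_trans xc)// ltrDl.
Qed.

(** Open rays form a pi-system generating the Borel sets, and the rays [g k], of finite measure,
    exhaust the line; uniqueness of measures concludes. *)
Lemma trig_determines_law (A : set R) : measurable A -> mu A = nu A.
Proof.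
have mG : @measurable _ R = <<s @RGenOInfty.G R >> by exact: RGenOInfty.measurableE.
have GI : setI_closed (@RGenOInfty.G R).
  move=> _ _ [x ->] [y ->]; exists (Num.max x y).
  apply/seteqP; split=> z; rewrite /= !in_itv/= !andbT gt_max.
    by move=> [-> ->].
  by move=> /andP[].
pose g (k : nat) : set R := `](- k%:R), +oo[%classic.
have Gg k : @RGenOInfty.G R (g k) by exists (- k%:R).
have gT : \bigcup_k g k = setT.
  apply/seteqP; split=> // x _; exists (Num.truncn `|x|).+1 => //.
  rewrite /g/= in_itv/= andbT ltrNl (le_lt_trans (ler_norm _))// normrN.
  exact: truncnS_gt.
have munuG B : @RGenOInfty.G R B -> mu B = nu B.
  move=> [x ->]; have [_] := same_integral_ray x.
  rewrite /Rintegral !integral_indic// !setIT => E.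
  by rewrite -[LHS]fineK ?fin_num_measure// E fineK ?fin_num_measure.
have muy k : (mu (g k) < +oo)%E.
  by rewrite ltey_eq fin_num_measure//; exact: measurable_itv.
exact: (@measure_unique _ R R (@RGenOInfty.G R) g mG GI Gg gT mu nu munuG muy A).
Qed.

End law_determination.

(** * Expansion of the integrand in elementary symmetric polynomials *)

Section elementary_symmetric.
Context {R : realType}.

Lemma elem_sym0 n (x : 'I_n -> R) : elem_sym 0 x = 1.
Proof.
rewrite elem_symE (big_pred1 finset.set0) => [|A]; first by rewrite big_set0.
by rewrite /= cards_eq0.
Qed.

Lemma elem_sym_full n (x : 'I_n -> R) : elem_sym n x = \prod_i x i.
Proof.
rewrite elem_symE (big_pred1 [set: 'I_n]%SET) => [|A].
  by apply: eq_bigl => i; rewrite finset.in_setT.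
rewrite /= eqEcard finset.subsetT/= cardsT card_ord eqn_leq.
by rewrite (leq_trans (max_card _))// card_ord.
Qed.

(** As [e_0 = 1], the terms of order zero cancel in [A f - A_k f]; as [A_k] has one factor fewer,
    the derivative of order [n.+1] comes from [A] alone, with the full product as coefficient. *)
Lemma stein_integrandE (n : nat) (wt a : 'I_n.+1 -> R) (f : R -> R) (y : R) :
  stein_integrand wt a f y =
  (y + \sum_(i < n.+1) wt i) * (-1) ^+ n.+1 * (\prod_(j < n.+1) a j) * derive1n n.+1 f y
  + \sum_(1 <= l < n.+1)
      (-1) ^+ l * (y * elem_sym l a
        + \sum_(k < n.+1) wt k * (elem_sym l a - elem_sym l (drop_entry k a))) * derive1n l f y
  + y * f y.
Proof.
pose A := \sum_(1 <= l < n.+1) (-1) ^+ l * elem_sym l a * derive1n l f y.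
pose B k := \sum_(1 <= l < n.+1) (-1) ^+ l * elem_sym l (drop_entry k a) * derive1n l f y.
pose D := (-1) ^+ n.+1 * (\prod_(j < n.+1) a j) * derive1n n.+1 f y.
have AE : diffop (symbol_poly a) f y = f y + A + D.
  rewrite diffop_symbol_poly big_ord_recr/= elem_sym_full -/D; congr (_ + _).
  rewrite -(big_mkord predT (fun l => (-1) ^+ l * elem_sym l a * derive1n l f y)).
  by rewrite big_ltn// expr0 elem_sym0 !mul1r.
have BE k : diffop (symbol_poly (drop_entry k a)) f y = f y + B k.
  rewrite diffop_symbol_poly.
  rewrite -(big_mkord predT (fun l => (-1) ^+ l * elem_sym l (drop_entry k a) * derive1n l f y)).
  by rewrite big_ltn// expr0 elem_sym0 !mul1r.
have -> : \sum_(1 <= l < n.+1) (-1) ^+ l * (y * elem_sym l a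
        + \sum_(k < n.+1) wt k * (elem_sym l a - elem_sym l (drop_entry k a))) * derive1n l f y =
    y * A + \sum_(k < n.+1) wt k * (A - B k).
  rewrite /A mulr_sumr; under [X in _ + X]eq_bigr do rewrite -sumrB mulr_sumr.
  rewrite exchange_big -big_split/=; apply: eq_bigr => l _.
  have -> : \sum_(k < n.+1) wt k * ((-1) ^+ l * elem_sym l a * derive1n l f y -
      (-1) ^+ l * elem_sym l (drop_entry k a) * derive1n l f y) =
      (-1) ^+ l * (\sum_(k < n.+1) wt k * (elem_sym l a - elem_sym l (drop_entry k a))) *
      derive1n l f y.
    by rewrite [in RHS]mulr_sumr [in RHS]mulr_suml; apply: eq_bigr => k _; ring.
  by ring.
rewrite /stein_integrand AE.
have -> : \sum_(k < n.+1) wt k * (f y + A + D - diffop (symbol_poly (drop_entry k a)) f y) =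
    \sum_(k < n.+1) wt k * (A - B k) + (\sum_(k < n.+1) wt k) * D.
  by rewrite mulr_suml -big_split/=; apply: eq_bigr => k _; rewrite BE; ring.
by rewrite /D; ring.
Qed.

End elementary_symmetric.

Theorem theorem2p2 (R : realType) (d : nat) (hd : (1 <= d)%N)
    (m : 'I_d -> nat) (hm : forall i, (0 < m i)%N)
    (lambda : 'I_d -> R) (hlambda0 : forall i, lambda i != 0)
    (hlambda : injective lambda)
    (alpha : 'I_d -> R) (halpha : forall i, 0 < alpha i)
    (c : 'I_d -> R) (hc : forall i, 0 < c i)
    (dT : measure_display) (T : measurableType dT) (P : probability T R)
    (gam : 'I_d -> {RV P >-> R})
    (hgam : forall i,
      gamma_distributed P (gam i) ((m i)%:R * alpha i) (c i))
    (hindep : mutually_independent P gam)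
    (dU : measure_display) (U : measurableType dU) (Q : probability U R)
    (Y : {RV Q >-> R}) (hY : ('E_Q[fun w => (`|Y w|)%R] < +oo)%E) :
  let lc := fun i => lambda i * c i in
  let F := fun w : T =>
    \sum_(i < d) lambda i * (gam i w - (m i)%:R * alpha i * c i) in
  same_law Q P Y F <->
  forall f : R -> R, schwartz f ->
    ('E_Q[fun w =>
      ((Y w + \sum_(i < d) lambda i * (m i)%:R * alpha i * c i)
        * (-1) ^+ d * (\prod_(j < d) (lambda j * c j)) * f^`(d)%classic (Y w)
      + \sum_(1 <= l < d)
          (-1) ^+ l
          * (Y w * elem_sym l lc
             + \sum_(k < d) lambda k * (m k)%:R * alpha k * c k
                 * (elem_sym l lc - elem_sym l (drop_entry k lc)))
          * f^`(l)%classic (Y w)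
      + Y w * f (Y w))%R] = 0)%E.
Proof.
move=> lc F; case: d hd m hm lambda hlambda0 hlambda alpha halpha c hc gam hgam hindep @lc @F => //.
move=> n _ m hm lambda _ _
  alpha halpha c hc gam hgam hindep lc F.
pose k i := (m i)%:R * alpha i.
have k0 i : 0 < k i by rewrite mulr_gt0// ltr0n.
(* Shape times [lc i]: the factorisation of the weight under which [trig_unique] sees a square. *)
pose wt i := k i * lc i.
have wtE : (fun i => lambda i * k i * c i) = wt by apply/funext => i; rewrite /wt /lc; ring.
have igam i : P.-integrable setT (EFin \o gam i).
  exact: gamma_distributed_integrable (k0 i) (hc i) (hgam i).
have iF : P.-integrable setT (EFin \o F).
  have h i : P.-integrable setT (EFin \o (fun w => lambda i * (gam i w - k i * c i))).
    have := integrableZl measurableT (lambda i) (integrableB measurableT (igam i)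
      (finite_measure_integrable_cst P (k i * c i) measurableT)).
    by apply: eq_integrable => // w _ /=; rewrite EFinM EFinB.
  have := integrable_sum measurableT (index_enum 'I_n.+1) (P := predT) (fun i _ => h i).
  by apply: eq_integrable => // w _ /=; rewrite sumEFin.
have mF : measurable_fun setT F by have /integrableP[/measurable_EFinP] := iF.
have iY : Q.-integrable setT (EFin \o Y).
  apply/integrableP; split; first exact/measurable_EFinP.
  by move: hY; rewrite unlock.
pose muF : probability R R := distribution P (mfun_of mF).
pose muY : probability R R := distribution Q Y.
have imuF : muF.-integrable setT (EFin \o (fun x : R => x)).
  by apply/(integrable_distribution P (mfun_of mF) (f := fun x : R => x)).
have imuY : muY.-integrable setT (EFin \o (fun x : R => x)).
  by apply/(integrable_distribution Q Y (f := fun x : R => x)).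
(* This serves both directions: on Schwartz functions it gives the identity for [Y], on
   trigonometric ones the differential equation for [F]. *)
have steinF f : smooth_bounded f -> \int[muF]_x stein_integrand wt lc f x = 0.
  move=> sf; rewrite (Rintegral_distribution (X := mfun_of mF)).
  - have := @gamma_combination_stein _ _ _ P _ gam k c lambda k0 hc hgam hindep f sf.
    by rewrite /= wtE.
  - exact: measurable_stein_integrand.
  - apply/integrable_distribution; first exact: measurable_stein_integrand.
    exact: integrable_stein_integrand.
have EY f : smooth_bounded f ->
    ('E_Q[fun w => stein_integrand wt lc f (Y w)] = (\int[muY]_x stein_integrand wt lc f x)%:E)%E.
  move=> sf; have ms := measurable_stein_integrand wt lc sf.
  have iG := integrable_stein_integrand wt lc imuY sf.
  rewrite unlock fineK; last exact: (integrable_fin_num measurableT iG).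
  rewrite integral_distribution//; first exact/measurable_EFinP.
  exact/(integrable_distribution Q Y ms).
have integrandE f : (fun w => (Y w + \sum_(i < n.+1) lambda i * (m i)%:R * alpha i * c i)
        * (-1) ^+ n.+1 * (\prod_(j < n.+1) (lambda j * c j)) * f^`(n.+1)%classic (Y w)
      + \sum_(1 <= l < n.+1)
          (-1) ^+ l
          * (Y w * elem_sym l lc
             + \sum_(k < n.+1) lambda k * (m k)%:R * alpha k * c k
                 * (elem_sym l lc - elem_sym l (drop_entry k lc)))
          * f^`(l)%classic (Y w)
      + Y w * f (Y w)) = (fun w => stein_integrand wt lc f (Y w)).
  have -> : wt = (fun i => lambda i * (m i)%:R * alpha i * c i).
    by apply/funext => i; rewrite /wt /k /lc; ring.
  by apply/funext => w; rewrite stein_integrandE.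
split=> [YF f sf|H].
  rewrite integrandE EY; last exact: schwartz_smooth_bounded.
  suff -> : \int[muY]_x stein_integrand wt lc f x = \int[muF]_x stein_integrand wt lc f x.
    by rewrite steinF//; exact: schwartz_smooth_bounded.
  by rewrite /Rintegral; congr fine; apply: eq_measure_integral => A mA _; exact: YF.
have steinY f : smooth_bounded f -> \int[muY]_x stein_integrand wt lc f x = 0.
  apply: stein_identity_smooth_bounded => // g sg.
  have := H g sg; rewrite integrandE EY; last exact: schwartz_smooth_bounded.
  by case.
have := trig_unique k0 imuY imuF (stein_identity_trig imuY steinY)
  (stein_identity_trig imuF steinF).
by move=> /trig_determines_law E A mA; exact: E.
Qed.
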